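(* Let $n\ge 2$, $Q=n+2$ (so $Q\ge4$) and $0<R\leq\infty$. Let $W$ be any real-valued function on $(0,R)$ for which the integrals below are well defined. Then $$\int_{B_{R}(o)} \frac{(\mathcal{L}_G u)^{2}}{|\nabla_G \varrho|^{2}} \,dx\,dt \geq \int_{B_{R}(o)} W(\varrho)|u|^{2}|\nabla_G \varrho|^2\,dx\,dt \quad \text{ for all } u\in C_{c}^{\infty}(B_{R}(o) \setminus\{o\})$$ if and only if $$\int_{B_{R}(o)} \frac{(\mathcal{L}_G u)^{2}}{|\nabla_G \varrho|^{2}} \,dx\,dt \geq \int_{B_{R}(o)} W(\varrho)|u|^{2}|\nabla_G \varrho|^2\,dx\,dt \quad \text{ for all } u\in C_{c,rad}^{\infty}(B_{R}(o) \setminus\{o\}).$$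
   Context: Grushin space: fix an integer $n\ge 2$ and put $Q=n+2$ (homogeneous dimension). Points of $\mathbb{R}^{n+1}$ are written $(x,t)$ with $x\in\mathbb{R}^n$, $t\in\mathbb{R}$; $o$ is the origin; all functions are real-valued. The Grushin gradient is $\nabla_G u=(\nabla_x u,\ |x|\partial_t u)$ and the Grushin operator is $\mathcal{L}_G=\Delta_x+|x|^2\partial_t^2$. The homogeneous norm is $\varrho(x,t)=(|x|^4+4t^2)^{1/4}$; it satisfies $|\nabla_G\varrho|^2=|x|^2/\varrho^2$ away from $o$. For $0<R\le\infty$, $B_R(o)=\{(x,t):\varrho(x,t)<R\}$ (so $B_\infty(o)=\mathbb{R}^{n+1}$). $C^\infty_{c,rad}(B_R(o)\setminus\{o\})$ is the set of functions in $C^\infty_c(B_R(o)\setminus\{o\})$ that are radial, i.e. depend only on $\varrho(x,t)$. Integrals of nonnegative functions may take the value $+\infty$. *)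

(* Defs.v *)
From HB Require Import structures.
From mathcomp Require Import all_boot all_order all_algebra.
From mathcomp Require Import all_classical all_reals all_analysis.
From mathcomp Require Import measurable_realfun.

Set Implicit Arguments.
Unset Strict Implicit.
Unset Printing Implicit Defensive.

Import Order.TTheory GRing.Theory Num.Theory.
Import numFieldNormedType.Exports.

Local Open Scope classical_set_scope.
Local Open Scope ring_scope.

Definition rV_display : measure_display.
Proof. exact. Qed.

Section measurable_rV.
Context {R : realType} (n : nat).

Let coor (i : 'I_n) (x : 'rV[R]_n) : measurableTypeR R := x ord0 i.

Let rV_set0 : g_sigma_preimage coor set0.
Proof. exact: sigma_algebra0. Qed.

Let rV_setC A : g_sigma_preimage coor A -> g_sigma_preimage coor (~` A).
Proof. exact: sigma_algebraC. Qed.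

Let rV_bigcup (F : (set 'rV[R]_n)^nat) :
  (forall i, g_sigma_preimage coor (F i)) ->
  g_sigma_preimage coor (\bigcup_i (F i)).
Proof. exact: sigma_algebra_bigcup. Qed.

(* The sigma-algebra generated by the coordinates, i.e. the Borel sets. *)
HB.instance Definition _ := @isMeasurable.Build rV_display
  'rV[R]_n (g_sigma_preimage coor) rV_set0 rV_setC rV_bigcup.

Lemma measurable_coor (i : 'I_n) : measurable_fun [set: 'rV[R]_n] (coor i).
Proof.
move=> _ Y mY; rewrite setTI; apply: sub_sigma_algebra => /=.
rewrite -bigcup_seq/=; exists i => /=; first by rewrite mem_index_enum.
by exists Y => //; rewrite setTI.
Qed.

Lemma measurable_fun_rV d (T : measurableType d) (f : T -> 'rV[R]_n) :
  (forall i, measurable_fun [set: T] (coor i \o f)) ->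
  measurable_fun [set: T] f.
Proof.
move=> mf; pose G := \big[setU/set0]_(i < n)
  preimage_set_system setT (coor i) measurable.
apply: (@measurability _ _ _ _ _ _ G) => // _ [A GA <-].
move: GA; rewrite /G -bigcup_seq => -[i _ [B mB <-]].
by rewrite setTI; exact: mf.
Qed.

End measurable_rV.

Section rV_lebesgue.
Context {R : realType}.

Definition rV_cons n (p : measurableTypeR R * 'rV[R]_n) : 'rV[R]_n.+1 :=
  row_mx (p.1%:M : 'rV[R]_1) p.2.

Let rV_uncons n (x : 'rV[R]_n.+1) : measurableTypeR R * 'rV[R]_n :=
  (x ord0 ord0, \row_i x ord0 (lift ord0 i)).

Let rV_cons0 n p : @rV_cons n p ord0 ord0 = p.1.
Proof.
rewrite /rV_cons mxE; case: splitP => [j _|j /= /eqP//].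
by rewrite !ord1 !mxE.
Qed.

Let rV_consS n p i : @rV_cons n p ord0 (lift ord0 i) = p.2 ord0 i.
Proof.
rewrite /rV_cons mxE; case: splitP => [j|j] /=; first by rewrite ord1.
by move=> /eqP; rewrite eqSS => /eqP/val_inj ->.
Qed.

Let rV_consK n : cancel (@rV_cons n) (@rV_uncons n).
Proof.
move=> p; rewrite /rV_uncons rV_cons0 [RHS]surjective_pairing; congr (_, _).
by apply/rowP => i; rewrite mxE rV_consS.
Qed.

Lemma measurable_rV_cons n : measurable_fun setT (@rV_cons n).
Proof.
apply: measurable_fun_rV => i; case: (unliftP ord0 i) => [j|] ->.
  rewrite [X in measurable_fun _ X](_ : _ = 
    fun p : measurableTypeR R * 'rV[R]_n => p.2 ord0 j); last first.
    by apply/funext => p /=; rewrite rV_consS.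
  by apply: (measurableT_comp (measurable_coor j)); exact: measurable_snd.
rewrite [X in measurable_fun _ X](_ : _ = fst); first exact: measurable_fst.
by apply/funext => p /=; rewrite rV_cons0.
Qed.

Let measurable_rV_uncons n : measurable_fun setT (@rV_uncons n).
Proof.
apply: measurable_fun_pair; first exact: measurable_coor.
apply: measurable_fun_rV => i.
rewrite [X in measurable_fun _ X](_ : _ =
    fun x : 'rV[R]_n.+1 => x ord0 (lift ord0 i) : measurableTypeR R);
  last first.
  by apply/funext => p /=; rewrite mxE.
exact: measurable_coor.
Qed.

HB.instance Definition _ n := isMeasurableFun.Build _ _ _ _
  (@rV_cons n) (@measurable_rV_cons n).

Section succ.
Local Open Scope ereal_scope.
Variables (n : nat) (mu : {sigma_finite_measure set 'rV[R]_n -> \bar R}).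

Definition rV_lebesgue_succ : set 'rV[R]_n.+1 -> \bar R :=
  pushforward (@lebesgue_measure R \x mu) (@rV_cons n).

Let succ0 : rV_lebesgue_succ set0 = 0.
Proof. exact: measure0. Qed.

Let succ_ge0 A : 0 <= rV_lebesgue_succ A.
Proof. exact: measure_ge0. Qed.

Let succ_sigma_additive : semi_sigma_additive rV_lebesgue_succ.
Proof. exact: measure_semi_sigma_additive. Qed.

HB.instance Definition _ := isMeasure.Build _ _ _ rV_lebesgue_succ
  succ0 succ_ge0 succ_sigma_additive.

Let succ_sigma_finite : sigma_finite setT rV_lebesgue_succ.
Proof.
have /sigma_finiteP[F [TF ndF Foo]] := sigma_finiteT (@lebesgue_measure R).
have /sigma_finiteP[G [TG ndG Goo]] := sigma_finiteT mu.
exists (fun k => @rV_uncons n @^-1` (F k `*` G k)).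
  apply/esym; rewrite -subTset => x _.
  have [i _ Fi] : (\bigcup_i F i) (rV_uncons x).1 by rewrite -TF.
  have [j _ Gj] : (\bigcup_j G j) (rV_uncons x).2 by rewrite -TG.
  exists (maxn i j) => //; split.
  - by move: Fi; exact/subsetPset/ndF/leq_maxl.
  - by move: Gj; exact/subsetPset/ndG/leq_maxr.
move=> k; have [mF Fk] := Foo k; have [mG Gk] := Goo k; split.
  rewrite -[X in measurable X]setTI; apply: measurable_rV_uncons => //.
  exact: measurableX.
rewrite /rV_lebesgue_succ /pushforward.
rewrite (_ : _ @^-1` _ = F k `*` G k); last first.
  by rewrite -comp_preimage (_ : _ \o _ = id)//; apply/funext/rV_consK.
by rewrite product_measure1E// lte_mul_pinfty// ge0_fin_numE.
Qed.

HB.instance Definition _ := Measure_isSigmaFinite.Build _ _ _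
  rV_lebesgue_succ succ_sigma_finite.

End succ.

(* n-fold product of the one-dimensional Lebesgue measure. *)
Fixpoint rV_lebesgue n : {sigma_finite_measure set 'rV[R]_n -> \bar R} :=
  if n is m.+1 then rV_lebesgue_succ (rV_lebesgue m) else \d_(0 : 'rV[R]_0).

End rV_lebesgue.

Section function_classes.
Context {R : realType}.

Fixpoint iter_derive (V : normedModType R) (vs : seq V) (u : V -> R) : V -> R :=
  if vs is v :: ws then 'D_v (iter_derive ws u) else u.

(* C^oo: u and all its iterated directional derivatives are (Frechet)
   differentiable everywhere. *)
Definition smooth (V : normedModType R) (u : V -> R) : Prop :=
  forall (vs : seq V) (z : V), differentiable (iter_derive vs u) z.

(* Elements of C_c^oo(A) are represented by their extension by zero to V. *)
Definition Cc_smooth (V : normedModType R) (A : set V) (u : V -> R) : Prop :=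
  [/\ smooth u, compact (closure [set z | u z != 0]) &
      closure [set z | u z != 0] `<=` A].

(* The Lebesgue integral of f over D makes sense in [-oo, +oo]: f is measurable
   for the completion of mu (i.e. agrees almost everywhere with a function
   measurable for the underlying sigma-algebra) and the integrals of its
   positive and negative parts are not both infinite. *)
Definition integral_defined d (T : measurableType d)
    (mu : {measure set T -> \bar R}) (D : set T) (f : T -> \bar R) : Prop :=
  (exists g : T -> \bar R,
     measurable_fun D g /\ {ae mu, forall z, D z -> f z = g z}) /\
  (\int[mu]_(z in D) f^\+ z < +oo \/ \int[mu]_(z in D) f^\- z < +oo)%E.

End function_classes.

Section grushin.
Context {R : realType} {n : nat}.

Local Notation pt := ('rV[R]_n * R)%type.
Implicit Types (x : 'rV[R]_n) (z : pt) (u : pt -> R).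

(* The norm `|x| of the library is the sup norm on row vectors. *)
Definition enorm x : R := Num.sqrt (\sum_i x ord0 i ^+ 2).

Definition dir_x (i : 'I_n) : pt := (delta_mx ord0 i, 0).
Definition dir_t : pt := (0, 1).

Definition grushin_grad u z : pt :=
  (\row_i 'D_(dir_x i) u z, enorm z.1 * 'D_dir_t u z).

Definition grushin_grad_norm u z : R :=
  Num.sqrt (enorm (grushin_grad u z).1 ^+ 2 + (grushin_grad u z).2 ^+ 2).

Definition grushin_op u z : R :=
  \sum_i 'D_(dir_x i) ('D_(dir_x i) u) z
  + enorm z.1 ^+ 2 * 'D_dir_t ('D_dir_t u) z.

Definition rho z : R := (enorm z.1 ^+ 4 + 4 * z.2 ^+ 2) `^ (1 / 4).

Definition grushin_ball (r : \bar R) : set pt := [set z | ((rho z)%:E < r)%E].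

Definition grushin_radial u : Prop := exists phi : R -> R, u = phi \o rho.

Definition grushin_lebesgue : set ('rV[R]_n * measurableTypeR R) -> \bar R :=
  (rV_lebesgue n \x @lebesgue_measure R)%E.

HB.instance Definition _ := Measure.on grushin_lebesgue.

(* |grad rho| vanishes only on the null set {x = 0} away from the origin, so the
   convention a / 0 = 0 does not affect the integral. *)
Definition rellich_lhs (r : \bar R) u : \bar R :=
  \int[grushin_lebesgue]_(z in grushin_ball r)
    (grushin_op u z ^+ 2 / grushin_grad_norm rho z ^+ 2)%:E.

(* Only the values of W on ]0, r[ matter when u vanishes at the origin. *)
Definition rellich_weight (W : R -> R) u z : \bar R :=
  (W (rho z) * `|u z| ^+ 2 * grushin_grad_norm rho z ^+ 2)%:E.

Definition rellich_rhs (r : \bar R) (W : R -> R) u : \bar R :=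
  \int[grushin_lebesgue]_(z in grushin_ball r) rellich_weight W u z.

Definition rellich_defined (r : \bar R) (W : R -> R) u : Prop :=
  integral_defined grushin_lebesgue (grushin_ball r) (rellich_weight W u).

End grushin.

(* Main.v *)
Require Import Defs.
From HB Require Import structures.
From mathcomp Require Import all_boot all_order all_algebra.
From mathcomp Require Import all_classical all_reals all_analysis.
From mathcomp Require Import measurable_realfun ring lra.

(* Let E be the generator of the dilations (x, t) -> (s x, s^2 t), put
   w = |grad_G rho|^2 and A u = rho^-2 (E^2 u + n E u); if u is radial then
   L_G u = w A u.  The nontrivial implication follows from two inequalities,
   which replace an expansion of u in spherical harmonics.

   (1) For every u, the integral of (L_G u)^2 / w is at least that of w (A u)^2.
   Since (L_G u)^2 / w >= 2 A u L_G u - w (A u)^2, it is enough that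
   A u (L_G u - w A u) has a nonnegative integral.  This function is a divergence
   plus rho^-2 (Gam(E u, E u) + (Q - 4) Gam(u, u)), where Gam >= 0 is the square
   of the Grushin gradient without its radial part.

   (2) For z <> 0, the function y -> u(delta_(rho(y) / rho(z)) z) is radial, and
   the Grushin operator maps it to w(y) (A u)(delta_(rho(y) / rho(z)) z).
   Averaging the hypothesis for these functions over z, with a weight
   w(z) chi(rho(z)) rho(z)^-Q, turns both sides into a constant multiple of
   integrals over the whole space, and bounds the integral of W(rho) u^2 w by
   that of w (A u)^2. *)

(** On a radial function phi(rho), L_G gives w (phi'' + (Q - 1) phi' / rho), while E acts as rho
    d/drho and E^2 phi = rho^2 phi'' + rho phi'; hence the coefficient Q - 2 = n in A. The sign in
    (1) rests on two algebraic facts: Gam is homogeneous of degree -2 under dilations, and radial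
    factors are constants for it, so Gam(A u, u) only involves Gam of u, E u and E^2 u. Integrating
    by parts along the dilations produces the coefficient Q - 4, which is nonnegative because n is
    at least 2. In (2) the average replaces polar coordinates: no surface measure on the unit sphere
    is built, only Tonelli and the Jacobian of dilations are used. The cut-off chi is there because
    the dilation-invariant density w rho^-Q has infinite total mass. The obstacle in (2) is that W
    is arbitrary: W(rho) u^2 w is measurable only up to a null set, and the integrals of its
    positive and negative parts may be infinite. The averaging identity is therefore proved for
    nonnegative Borel functions, the two parts are kept on opposite sides of the inequality, and the
    exceptional null set is shown to be invisible along almost every family of rays. *)

Set Implicit Arguments.
Unset Strict Implicit.
Unset Printing Implicit Defensive.

Import Order.TTheory GRing.Theory Num.Theory.
Import numFieldNormedType.Exports.

Local Open Scope classical_set_scope.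
Local Open Scope ring_scope.

(** * C^k functions and symmetry of second derivatives *)

Section Ck.
Context {R : realType} {V : normedModType R}.
Implicit Types (f g : V -> R) (U : set V).

(** Order and domain are explicit: [smooth] is global, whereas [rho] and [p] are regular on the
    punctured space only, and closure under products goes by induction on the order. *)
Fixpoint Ck U (k : nat) f : Prop :=
  (forall z, U z -> differentiable f z) /\
  (if k is k'.+1 then forall v, Ck U k' ('D_v f) else True).

Lemma Ck_diff U k f z : Ck U k f -> U z -> differentiable f z.
Proof. by case: k => [|k] [+ _]; exact. Qed.

Lemma Ck_derivable U k f z v : Ck U k f -> U z -> derivable f z v.
Proof. by move=> /Ck_diff + Uz => /(_ _ Uz)/diff_derivable. Qed.

Lemma Ck_derive U k f v : Ck U k.+1 f -> Ck U k ('D_v f).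
Proof. by case=> _; exact. Qed.

Lemma CkW U k f : Ck U k.+1 f -> Ck U k f.
Proof.
elim: k f => [|k IH] f [df Df]; split=> //.
by move=> v; exact: IH.
Qed.

Lemma Ck_cst U k c : Ck U k (cst c).
Proof.
elim: k c => [|k IH] c; split=> // v.
rewrite (_ : 'D_v _ = cst 0); first exact: IH.
by apply/funext => z; rewrite derive_cst.
Qed.

Lemma smooth_Ck U f k : smooth f -> Ck U k f.
Proof.
suff H vs : smooth f -> Ck U k (iter_derive vs f) by exact: (H [::]).
move=> sf; elim: k vs => [|k IH] vs; split=> //; [by move=> z _; exact: sf..|].
by move=> v; exact: (IH (v :: vs)).
Qed.

Lemma Ck_smooth f : (forall k, Ck setT k f) -> smooth f.
Proof.
move=> Cf vs z; suff : Ck setT 0 (iter_derive vs f) by case=> + _; exact.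
suff H k : Ck setT k (iter_derive vs f) by exact: H.
elim: vs k => [|v vs IH] k //=; exact: Ck_derive.
Qed.

(** Differentiability depends on the germ only: the first-order expansion of [f] at [z] is also one
    of [g]. *)
Lemma differentiable_near_eq f g (z : V) :
  (\near z, f z = g z) -> differentiable f z -> differentiable g z.
Proof.
move=> fg /diff_locallyP[cf ef]; have fgz := nbhs_singleton fg.
have fgs : \forall h \near 0, f (h + z) = g (h + z).
  by move: fg; rewrite (near_shift 0); apply: filterS => h /=; rewrite subr0.
have eg : g \o shift z = cst (g z) + 'd f z +o_ 0 id.
  apply/eqaddoP => _/posnumP[e]; have /eqaddoP/(_ _ (gt0 e)) := ef.
  move=> H; apply: filterS2 fgs H => h /= fgh; rewrite !fctE /= -fgz.
  by rewrite fgh.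
have dg := diff_unique cf eg.
by apply/diff_locallyP; rewrite dg.
Qed.

Section open_domain.
Variables (U : set V) (oU : open U).

Lemma near_eq_on f g z : {in U, f =1 g} -> U z -> \near z, f z = g z.
Proof.
move=> fg Uz; have : nbhs z U by exact: open_nbhs_nbhs.
by apply: filterS => y /mem_set; exact: fg.
Qed.

Lemma derive_eq_on f g z v : {in U, f =1 g} -> U z -> 'D_v f z = 'D_v g z.
Proof. by move=> fg Uz; exact/near_eq_derive/near_eq_on. Qed.

Lemma Ck_eq_on k f g : {in U, f =1 g} -> Ck U k f -> Ck U k g.
Proof.
elim: k f g => [|k IH] f g fg [df Df]; split=> //.
- by move=> z Uz; exact: differentiable_near_eq (near_eq_on fg Uz) (df _ Uz).
- by move=> z Uz; exact: differentiable_near_eq (near_eq_on fg Uz) (df _ Uz).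
- move=> v; apply: IH (Df v) => z /set_mem Uz; exact: derive_eq_on.
Qed.

Lemma CkD k f g : Ck U k f -> Ck U k g -> Ck U k (fun z => f z + g z).
Proof.
elim: k f g => [|k IH] f g [df Df] [dg Dg]; split=> //.
- by move=> z Uz; apply: differentiableD; [exact: df|exact: dg].
- by move=> z Uz; apply: differentiableD; [exact: df|exact: dg].
- move=> v; apply: Ck_eq_on (IH _ _ (Df v) (Dg v)) => z /set_mem Uz.
  by rewrite [RHS]deriveD//; apply: diff_derivable; [exact: df|exact: dg].
Qed.

Lemma CkM k f g : Ck U k f -> Ck U k g -> Ck U k (fun z => f z * g z).
Proof.
elim: k f g => [|k IH] f g Cf Cg.
  case: Cf Cg => [df _] [dg _]; split=> //.
  by move=> z Uz; apply: differentiableM; [exact: df|exact: dg].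
have [[df Df] [dg Dg]] := (Cf, Cg); split=> //.
  by move=> z Uz; apply: differentiableM; [exact: df|exact: dg].
move=> v; have := CkD (IH _ _ (CkW Cf) (Dg v)) (IH _ _ (CkW Cg) (Df v)).
apply: Ck_eq_on => z /set_mem Uz.
by rewrite [RHS]deriveM//; apply: diff_derivable; [exact: df|exact: dg].
Qed.

Lemma Ck_sum n k (F : 'I_n -> V -> R) : (forall i, Ck U k (F i)) ->
  Ck U k (fun z => \sum_i F i z).
Proof.
elim: n F => [|n IH] F CF.
  by apply: Ck_eq_on (Ck_cst U k 0) => z _; rewrite big_ord0.
have H := CkD (CF ord0) (IH (fun i => F (lift ord0 i)) (fun i => CF _)).
by apply: Ck_eq_on H => z _; rewrite big_ord_recl.
Qed.

Lemma CkZ k c f : Ck U k f -> Ck U k (fun z => c * f z).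
Proof. exact: CkM (Ck_cst _ _ _). Qed.

Lemma CkB k f g : Ck U k f -> Ck U k g -> Ck U k (fun z => f z - g z).
Proof.
move=> Cf Cg; apply: Ck_eq_on (CkD Cf (CkZ (-1) Cg)) => z _.
by rewrite mulN1r.
Qed.

Lemma CkX k f m : Ck U k f -> Ck U k (fun z => f z ^+ m).
Proof.
move=> Cf; elim: m => [|m IH].
  by apply: Ck_eq_on (Ck_cst U k 1) => z _; rewrite expr0.
by apply: Ck_eq_on (CkM Cf IH) => z _; rewrite exprS.
Qed.

Lemma DrM k f g z v : Ck U k f -> Ck U k g -> U z ->
  'D_v (fun z => f z * g z) z = 'D_v f z * g z + f z * 'D_v g z.
Proof.
move=> Cf Cg Uz; have [df dg] := (Ck_derivable (v := v) Cf Uz, Ck_derivable (v := v) Cg Uz).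
rewrite [LHS]deriveM//.
by rewrite addrC mulrC.
Qed.

Lemma DrD k f g z v : Ck U k f -> Ck U k g -> U z ->
  'D_v (fun z => f z + g z) z = 'D_v f z + 'D_v g z.
Proof.
move=> Cf Cg Uz; have [df dg] := (Ck_derivable (v := v) Cf Uz, Ck_derivable (v := v) Cg Uz).
by rewrite [LHS]deriveD. Qed.

Lemma DrB k f g z v : Ck U k f -> Ck U k g -> U z ->
  'D_v (fun z => f z - g z) z = 'D_v f z - 'D_v g z.
Proof.
move=> Cf Cg Uz; have [df dg] := (Ck_derivable (v := v) Cf Uz, Ck_derivable (v := v) Cg Uz).
by rewrite [LHS]deriveB. Qed.

Lemma DrZ k c f z v : Ck U k f -> U z ->
  'D_v (fun z => c * f z) z = c * 'D_v f z.
Proof.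
move=> Cf Uz; rewrite (DrM _ (Ck_cst U k c) Cf Uz).
by rewrite derive_cst mul0r add0r.
Qed.

Lemma Dr_sum n k (F : 'I_n -> V -> R) z v : (forall i, Ck U k (F i)) -> U z ->
  'D_v (fun z => \sum_i F i z) z = \sum_i 'D_v (F i) z.
Proof.
move=> CF Uz; rewrite -derive_sum; last by move=> i; exact: Ck_derivable Uz.
by congr ('D_v _ z); apply/funext => y; rewrite fct_sumE.
Qed.

End open_domain.
End Ck.

Section second_derivatives.
Context {R : realType} {V : normedModType R}.
Implicit Types (f : V -> R) (U : set V).

Lemma is_derive_line f (w a : V) (s : R) : differentiable f (s *: a + w) ->
  is_derive s 1 (fun s : R => f (s *: a + w)) ('D_a f (s *: a + w)).
Proof.
move=> df; pose l (s : R) := s *: a + w.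
have dl : differentiable l s.
  by apply: differentiableD => //; exact: differentiableZl.
have vl : 'd l s 1 = a.
  have dm : differentiable (fun s : R => s *: a) s by exact: differentiableZl.
  rewrite /l (diffD dm (differentiable_cst w s)) diff_cst.
  have -> : 'd ( *:%R^~ a) s = ( *:%R^~ a) :> (R -> V) by exact: diff_val.
  by rewrite /= addr0 scale1r.
have dc : differentiable (f \o l) s by exact: differentiable_comp.
split; first exact: diff_derivable.
by rewrite (deriveE _ dc) diff_comp//= vl deriveE.
Qed.

(** Symmetric in [a] and [b], while [second_differenceP] expands it with one mixed derivative or the
    other according to the order of [a] and [b]. *)
Definition second_difference f z a b (h : R) :=
  f (h *: a + (h *: b + z)) - f (h *: a + z) - f (h *: b + z) + f z.

(** The mean value theorem along [a] turns the second difference into [h] times an increment of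
    ['D_a f], and differentiability of ['D_a f] at [z] gives that increment up to o(h). *)
Lemma second_differenceP U f z a b : open U -> Ck U 1 f -> U z ->
  forall e : R, 0 < e -> \forall h \near 0^'+,
    `|second_difference f z a b h - h ^+ 2 * 'D_b ('D_a f) z| <= e * h ^+ 2.
Proof.
move=> oU Cf Uz e e0; set M := (1 + `|a| + `|b|).
have M0 : 0 < M by rewrite /M -addrA ltr_wpDr// addr_ge0.
have [d0 /= d00 d0U] : exists2 d : R, 0 < d & forall k : V, `|k| < d -> U (k + z).
  have /nbhs_ballP[d /= d0 dU] : nbhs z U by exact: open_nbhs_nbhs.
  exists d => // k kd; apply: dU; rewrite -ball_normE /ball_/=.
  by rewrite opprD addrCA subrr addr0 normrN.
have dDf : differentiable ('D_a f) z by exact: (Ck_diff (Ck_derive a Cf)).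
(* [h M] bounds the norm of [s *: a + t *: b] for [s], [t] in [0, h], so two remainders of size
   [e / (2 M) * h M] add up to [e h]. *)
have e1 : 0 < e / (2 * M) by rewrite divr_gt0// mulr_gt0.
have /diff_locallyP[_ /eqaddoP/(_ _ e1)] := dDf.
move=> /nbhs_ballP[d1 /= d10 d1P].
have {}d1P k : `|k| < d1 ->
    `|'D_a f (k + z) - ('D_a f z + 'd ('D_a f) z k)| <= e / (2 * M) * `|k|.
  by move=> kd; apply: d1P; rewrite -ball_normE /ball_/= sub0r normrN.
near=> h; have h0 : 0 < h by [].
have hM : h * M < Num.min d0 d1.
  by rewrite -ltr_pdivlMr//; near: h; apply: nbhs_right_lt; rewrite divr_gt0// lt_min d00.
have kM (s t : R) : 0 <= s <= h -> 0 <= t <= h -> `|s *: a + t *: b| <= h * M.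
  move=> /andP[s0 sh] /andP[t0 th]; rewrite (le_trans (ler_normD _ _))//.
  rewrite !normrZ !ger0_norm// /M !mulrDr mulr1 -addrA ler_wpDl ?(ltW h0)//.
  by apply: lerD; rewrite ler_wpM2r.
have kU (s t : R) : 0 <= s <= h -> 0 <= t <= h -> U (s *: a + (t *: b + z)).
  move=> hs ht; rewrite addrA; apply: d0U; rewrite (le_lt_trans (kM _ _ hs ht))//.
  by move: hM; rewrite lt_min => /andP[].
have k1 (s t : R) : 0 <= s <= h -> 0 <= t <= h ->
    `|'D_a f (s *: a + (t *: b + z)) - ('D_a f z + 'd ('D_a f) z (s *: a + t *: b))|
    <= e / 2 * h.
  move=> hs ht; rewrite addrA; apply: le_trans (d1P _ _) _.
    by rewrite (le_lt_trans (kM _ _ hs ht))//; move: hM; rewrite lt_min => /andP[].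
  rewrite (le_trans (ler_wpM2l (ltW e1) (kM _ _ hs ht)))//.
  by rewrite le_eqVlt; apply/orP; left; apply/eqP; field; rewrite gt_eqF.
have h0h : 0 <= h <= h by rewrite lexx ltW.
have h00 : 0 <= (0 : R) <= h by rewrite lexx ltW.
pose g (s : R) := f (s *: a + (h *: b + z)) - f (s *: a + z).
pose dg (s : R) := 'D_a f (s *: a + (h *: b + z)) - 'D_a f (s *: a + z).
have gd (s : R) : 0 <= s <= h -> is_derive s 1 g (dg s).
  move=> hs; apply: is_deriveB; apply: is_derive_line; apply: (Ck_diff Cf).
    exact: kU.
  by have := kU _ _ hs h00; rewrite scale0r add0r.
have [||c] := @MVT_segment _ g dg 0 h (ltW h0).
- by move=> s; rewrite in_itv/= => /andP[s0 sh]; apply: gd; rewrite !ltW.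
- apply: derivable_within_continuous => s; rewrite in_itv/= => hs.
  by have [] := gd _ hs.
rewrite in_itv/= => hc gE.
have -> : second_difference f z a b h = dg c * h.
  move: gE; rewrite subr0 => <-; rewrite /second_difference /g !scale0r !add0r.
  by rewrite opprB [in RHS]addrA; ring.
have := k1 _ _ hc h0h; have := k1 _ _ hc h00; rewrite scale0r add0r addr0.
have -> : 'd ('D_a f) z (c *: a + h *: b) =
    'd ('D_a f) z (c *: a) + h * 'd ('D_a f) z b by rewrite linearD !linearZ.
rewrite (deriveE _ dDf) /dg.
set A := 'D_a f _; set B := 'D_a f (_ + (_ + _)); set C := 'D_a f z.
set L := 'd _ _ _; set N := 'd _ _ _.
rewrite ler_norml => /andP[A1 A2]; rewrite ler_norml => /andP[B1 B2].
have -> : (B - A) * h - h ^+ 2 * N = ((B - A) - h * N) * h by ring.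
rewrite normrM (gtr0_norm h0) expr2 mulrA ler_wpM2r ?(ltW h0)//.
rewrite ler_norml; move: A1 A2 B1 B2; rewrite /GRing.scale/= => *; apply/andP; split; lra.
Unshelve. all: by end_near. Qed.

Lemma derive_comm U f z a b : open U -> Ck U 1 f -> U z ->
  'D_a ('D_b f) z = 'D_b ('D_a f) z.
Proof.
move=> oU Cf Uz.
have estimate (S P Q k e : R) : 0 < k -> `|S - k * P| <= e / 2 * k ->
    `|S - k * Q| <= e / 2 * k -> `|P - Q| <= e.
  move=> k0 SP SQ; rewrite -(ler_pM2r k0) -[X in `|_| * X](gtr0_norm k0) -normrM.
  have -> : (P - Q) * k = (S - k * Q) - (S - k * P) by ring.
  rewrite (le_trans (ler_normB _ _))// (le_trans (lerD SQ SP))//.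
  by rewrite -mulrDl -splitr.
pose P : R := 'D_b ('D_a f) z; pose Q : R := 'D_a ('D_b f) z.
suff PQ (e : R) : 0 < e -> `|P - Q| <= e.
  apply/esym/eqP; rewrite -subr_eq0 -normr_le0.
  by apply/ler_addgt0Pr => e e0; rewrite add0r; exact: PQ.
move=> e0.
have e2 : 0 < e / 2 by rewrite divr_gt0.
have nab := @second_differenceP U f z a b oU Cf Uz _ e2.
have nba := @second_differenceP U f z b a oU Cf Uz _ e2.
have [h [[/= h0 Hab] Hba]] := filter_ex (filterI (filterI (nbhs_right_gt 0) nab) nba).
have E : second_difference f z b a h = second_difference f z a b h.
  by rewrite /second_difference addrCA; ring.
rewrite {}E in Hba.
have h2 : 0 < h ^+ 2 by rewrite exprn_gt0.
exact: (estimate _ _ _ _ _ h2 Hab Hba).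
Qed.

End second_derivatives.

(** * Pointwise calculus on the punctured Grushin space *)

Section grushin_calculus.
Context {R : realType} {n : nat}.
Local Notation pt := ('rV[R]_n * R)%type.
Local Notation V := (pt : normedModType R).
Implicit Types (z v : pt) (f g u : pt -> R).

Lemma linear_fun_diff (f : pt -> R) z v : linear (f : pt -> R^o) -> continuous f ->
  differentiable f z /\ 'D_v f z = f v.
Proof.
move=> lf cf.
pose m := GRing.isLinear.Build R pt R^o *:%R f lf.
pose F : {linear pt -> R^o} := HB.pack f m.
have dF : differentiable F z by exact: linear_differentiable.
split; first exact: dF.
by rewrite (deriveE _ dF) diff_lin.
Qed.

Definition X (i : 'I_n) z : R := z.1 ord0 i.
Definition T z : R := z.2.

Lemma X_continuous i : continuous (X i).
Proof.
move=> z; apply: (@continuous_comp _ _ _ fst (fun x : 'rV[R]_n => x ord0 i)).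
  exact: cvg_fst.
exact: coord_continuous.
Qed.

Lemma T_continuous : continuous T.
Proof. by move=> z; exact: cvg_snd. Qed.

Lemma diff_X i z v : differentiable (X i) z /\ 'D_v (X i) z = X i v.
Proof.
apply: linear_fun_diff; last exact: X_continuous.
by move=> k a b; rewrite /X /= !mxE.
Qed.

Lemma diff_T z v : differentiable T z /\ 'D_v T z = T v.
Proof.
apply: linear_fun_diff; last exact: T_continuous.
by move=> k a b; rewrite /T /=.
Qed.

Definition punctured : set pt := ~` [set 0].
Local Notation U := punctured.

Lemma open_punctured : open U.
Proof. by rewrite openC; exact/accessible_closed_set1/hausdorff_accessible/norm_hausdorff. Qed.

(** The origin is excluded because [rho] is not differentiable there and [p] is unbounded near it;
    the test functions vanish in a neighbourhood of it. *)
Definition Cinf f := forall k, Ck U k f.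

Lemma smooth_Cinf f : smooth f -> Cinf f.
Proof. by move=> sf k; exact: smooth_Ck. Qed.

Lemma Cinf_cst c : Cinf (cst c).
Proof. by move=> k; exact: Ck_cst. Qed.

Lemma CinfD f g : Cinf f -> Cinf g -> Cinf (fun z => f z + g z).
Proof. by move=> Cf Cg k; apply: CkD => //; exact: open_punctured. Qed.

Lemma CinfB f g : Cinf f -> Cinf g -> Cinf (fun z => f z - g z).
Proof. by move=> Cf Cg k; apply: CkB => //; exact: open_punctured. Qed.

Lemma CinfM f g : Cinf f -> Cinf g -> Cinf (fun z => f z * g z).
Proof. by move=> Cf Cg k; apply: CkM => //; exact: open_punctured. Qed.

Lemma CinfZ c f : Cinf f -> Cinf (fun z => c * f z).
Proof. by move=> Cf k; apply: CkZ => //; exact: open_punctured. Qed.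

Lemma CinfX f m : Cinf f -> Cinf (fun z => f z ^+ m).
Proof. by move=> Cf k; apply: CkX => //; exact: open_punctured. Qed.

Lemma Cinf_sum m (F : 'I_m -> pt -> R) : (forall i, Cinf (F i)) ->
  Cinf (fun z => \sum_i F i z).
Proof. by move=> CF k; apply: Ck_sum => //; [exact: open_punctured|move=> i; exact: CF]. Qed.

Lemma Cinf_derive f v : Cinf f -> Cinf ('D_v f).
Proof. by move=> Cf k; apply: Ck_derive; exact: Cf. Qed.

Lemma Cinf_diff f z : Cinf f -> U z -> differentiable f z.
Proof. by move=> /(_ 0%N); exact: Ck_diff. Qed.

Lemma Cinf_linear (f : pt -> R) : (forall z v, differentiable f z /\ 'D_v f z = f v) ->
  Cinf f.
Proof.
move=> df [|k]; split=> //; [by move=> z _; case: (df z 0)..|].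
move=> v; rewrite (_ : 'D_v f = cst (f v)); first exact: Ck_cst.
by apply/funext => z; have [] := df z v.
Qed.

Lemma Cinf_X i : Cinf (X i). Proof. by apply: Cinf_linear; exact: diff_X. Qed.
Lemma Cinf_T : Cinf T. Proof. by apply: Cinf_linear; exact: diff_T. Qed.

Lemma DinfM f g z v : Cinf f -> Cinf g -> U z ->
  'D_v (fun z => f z * g z) z = 'D_v f z * g z + f z * 'D_v g z.
Proof. by move=> /(_ 0%N) Cf /(_ 0%N) Cg; exact: DrM Cf Cg. Qed.

Lemma DinfD f g z v : Cinf f -> Cinf g -> U z ->
  'D_v (fun z => f z + g z) z = 'D_v f z + 'D_v g z.
Proof. by move=> /(_ 0%N) Cf /(_ 0%N) Cg; exact: DrD Cf Cg. Qed.

Lemma DinfB f g z v : Cinf f -> Cinf g -> U z ->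
  'D_v (fun z => f z - g z) z = 'D_v f z - 'D_v g z.
Proof. by move=> /(_ 0%N) Cf /(_ 0%N) Cg; exact: DrB Cf Cg. Qed.

Lemma DinfZ c f z v : Cinf f -> U z -> 'D_v (fun z => c * f z) z = c * 'D_v f z.
Proof. by move=> /(_ 0%N) Cf; exact: DrZ Cf. Qed.

Lemma Dinf_sum m (F : 'I_m -> pt -> R) z v : (forall i, Cinf (F i)) -> U z ->
  'D_v (fun z => \sum_i F i z) z = \sum_i 'D_v (F i) z.
Proof. by move=> CF Uz; apply: (@Dr_sum _ _ U _ 0) => // i; exact: CF. Qed.

Lemma DinfX2 f z v : Cinf f -> U z ->
  'D_v (fun z => f z ^+ 2) z = 2 * f z * 'D_v f z.
Proof.
move=> Cf Uz; rewrite (_ : (fun z => _) = fun z => f z * f z).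
  by rewrite DinfM//; ring.
by apply/funext => y; rewrite expr2.
Qed.

(* Away from the origin, N = rho^4, p = rho^-2 and w = |grad_G rho|^2, while
   p and w vanish at the origin. *)
Definition r2 z : R := \sum_i X i z ^+ 2.
Definition N z : R := r2 z ^+ 2 + 4 * T z ^+ 2.

Lemma enorm2 z : enorm z.1 ^+ 2 = r2 z.
Proof. by rewrite /enorm sqr_sqrtr// sumr_ge0// => i _; rewrite sqr_ge0. Qed.

Lemma rhoE z : rho z = N z `^ (1 / 4).
Proof. by rewrite /rho /N -enorm2 -exprM. Qed.

Lemma r2_ge0 z : 0 <= r2 z.
Proof. by rewrite sumr_ge0// => i _; rewrite sqr_ge0. Qed.

Lemma N_ge0 z : 0 <= N z.
Proof. by rewrite addr_ge0 ?sqr_ge0// mulr_ge0 ?sqr_ge0. Qed.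

Lemma r2_eq0 z : r2 z = 0 -> z.1 = 0.
Proof.
move=> /eqP; rewrite psumr_eq0 => [|i _]; last exact: sqr_ge0.
move=> /allP H; apply/rowP => i; rewrite mxE.
by have := H i (mem_index_enum _); rewrite sqrf_eq0 => /eqP.
Qed.

Lemma N_gt0 z : U z -> 0 < N z.
Proof.
move=> Uz; rewrite lt_neqAle N_ge0 andbT eq_sym; apply/eqP => /eqP.
have T0 : 0 <= 4 * T z ^+ 2 by rewrite mulr_ge0 ?sqr_ge0.
rewrite /N paddr_eq0 ?sqr_ge0// sqrf_eq0 mulf_eq0 pnatr_eq0/= sqrf_eq0.
move=> /andP[/eqP/r2_eq0 z1 /eqP z2]; apply: Uz.
by move: z1 z2; clear T0; case: z => a b /= -> /=; rewrite /T /= => ->.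
Qed.

Lemma Cinf_r2 : Cinf r2.
Proof. by apply: Cinf_sum => i; exact/CinfX/Cinf_X. Qed.

Lemma Cinf_N : Cinf N.
Proof. by apply: CinfD; [exact/CinfX/Cinf_r2|exact/CinfZ/CinfX/Cinf_T]. Qed.

Definition powN a z : R := N z `^ a.

Lemma diff_powN a z v : U z -> differentiable (powN a) z /\
  'D_v (powN a) z = a * powN (a - 1) z * 'D_v N z.
Proof.
move=> Uz; have N0 := N_gt0 Uz.
have dN : differentiable N z by exact: (Cinf_diff Cinf_N).
have [dp vp] := is_derive1_powR a N0.
have dp' : differentiable (fun x : R => x `^ a) (N z) by exact/derivable1_diffP.
have dc : differentiable (powN a) z.
  exact: (@differentiable_comp _ _ _ _ N (fun x : R => x `^ a)).
split=> //; rewrite (deriveE _ dc) (deriveE _ dN).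
rewrite (_ : powN a = (fun x : R => x `^ a) \o N)// (diff_comp dN dp')/=.
set h := 'd N z v; rewrite -[h in LHS]mulr1 [LHS]linearZ/= mulrC -deriveE//.
by rewrite vp.
Qed.

(** The induction on the order runs over all exponents at once, since differentiating lowers [a] by
    one. *)
Lemma Cinf_powN a : Cinf (powN a).
Proof.
move=> k; elim: k a => [|k IH] a; split=> //.
- by move=> z Uz; have [] := diff_powN a 0 Uz.
- by move=> z Uz; have [] := diff_powN a 0 Uz.
move=> v; have H := CkZ open_punctured a
  (CkM open_punctured (IH (a - 1)) (Cinf_derive v Cinf_N k)).
apply: Ck_eq_on H => [|z /set_mem Uz]; first exact: open_punctured.
by have [_ ->] := diff_powN a v Uz; rewrite mulrA.
Qed.

Lemma powND a b z : U z -> powN (a + b) z = powN a z * powN b z.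
Proof. by move=> /N_gt0 N0; rewrite /powN powRD// (gt_eqF N0) implybT. Qed.

Definition p := powN (- (1 / 2)).

Lemma Cinf_p : Cinf p. Proof. exact: Cinf_powN. Qed.

Lemma p_gt0 z : U z -> 0 < p z.
Proof. by move=> /N_gt0; exact: powR_gt0. Qed.

Lemma p_ge0 z : 0 <= p z. Proof. exact: powR_ge0. Qed.

(** Through this relation the pointwise identities below become polynomial in [p], within reach of
    [ring]. *)
Lemma p2N z : U z -> p z ^+ 2 * N z = 1.
Proof.
move=> Uz; have N0 := N_gt0 Uz; rewrite expr2 /p -powND//.
rewrite (_ : _ + _ = -1); last by field.
by rewrite /powN powR_inv1 ?mulVf ?(ltW N0) ?gt_eqF.
Qed.

Lemma rho_gt0 z : U z -> 0 < rho z.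
Proof. by move=> /N_gt0; rewrite rhoE; exact: powR_gt0. Qed.

Lemma rho2p z : U z -> rho z ^+ 2 * p z = 1.
Proof.
move=> Uz; rewrite rhoE -/(powN _ _) expr2 /p -!powND//.
by rewrite (_ : _ + _ = 0) ?/powN ?powRr0//; field.
Qed.

Lemma Cinf_rho : Cinf rho.
Proof.
by rewrite (_ : rho = powN (1 / 4)); [exact: Cinf_powN|apply/funext => z; exact: rhoE].
Qed.

Definition D (i : 'I_n) f : pt -> R := 'D_(dir_x i) f.
Definition Dt f : pt -> R := 'D_dir_t f.

Lemma DX i j z : D i (X j) z = (i == j)%:R.
Proof. by rewrite /D; have [_ ->] := diff_X j z (dir_x i); rewrite /X /= mxE eqxx eq_sym. Qed.

Lemma DT i z : D i T z = 0.
Proof. by rewrite /D; have [_ ->] := diff_T z (dir_x i). Qed.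

Lemma DtX j z : Dt (X j) z = 0.
Proof. by rewrite /Dt; have [_ ->] := diff_X j z dir_t; rewrite /X /= mxE. Qed.

Lemma DtT z : Dt T z = 1.
Proof. by rewrite /Dt; have [_ ->] := diff_T z dir_t. Qed.

Lemma sum_delta (i : 'I_n) (F : 'I_n -> R) : \sum_j (i == j)%:R * F j = F i.
Proof.
rewrite (bigD1 i)//= eqxx mul1r big1 ?addr0// => j ji.
by rewrite eq_sym (negbTE ji) mul0r.
Qed.

Lemma derive_r2 z v : U z -> 'D_v r2 z = 2 * \sum_i X i z * X i v.
Proof.
move=> Uz; rewrite Dinf_sum//; last by move=> i; exact/CinfX/Cinf_X.
rewrite mulr_sumr; apply: eq_bigr => i _; rewrite DinfX2//; last exact: Cinf_X.
by have [_ ->] := diff_X i z v; rewrite mulrA.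
Qed.

Lemma derive_N z v : U z ->
  'D_v N z = 4 * r2 z * (\sum_i X i z * X i v) + 8 * T z * T v.
Proof.
move=> Uz; rewrite DinfD//; [|exact/CinfX/Cinf_r2|exact/CinfZ/CinfX/Cinf_T].
rewrite DinfZ//; last exact/CinfX/Cinf_T.
rewrite !DinfX2//; [|exact: Cinf_T|exact: Cinf_r2].
have [_ ->] := diff_T z v; rewrite derive_r2//; ring.
Qed.

Lemma derive_p z v : U z ->
  'D_v p z = - (1 / 2) * p z ^+ 3 * 'D_v N z.
Proof.
move=> Uz; have N0 := N_gt0 Uz; have [_ ->] := diff_powN (- (1 / 2)) v Uz.
congr (_ * _ * _); rewrite /p !exprS expr0 mulr1 -!powND//.
by congr (powN _ z); field.
Qed.

Lemma derive_rho z v : U z ->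
  'D_v rho z = rho z * (p z ^+ 2 * 'D_v N z / 4).
Proof.
move=> Uz; have N0 := N_gt0 Uz.
rewrite (_ : rho = powN (1 / 4)); last by apply/funext => y; exact: rhoE.
have [_ ->] := diff_powN (1 / 4) v Uz.
have -> : powN (1 / 4 - 1) z = powN (1 / 4) z * p z ^+ 2.
  rewrite /p !exprS expr0 mulr1 -!powND//.
  by congr (powN _ z); field.
by field.
Qed.

Lemma X_dir_x i j : X j (dir_x i) = (i == j)%:R.
Proof. by rewrite /X /= mxE eqxx eq_sym. Qed.

Lemma X_dir_t j : X j (@dir_t R n) = 0. Proof. by rewrite /X /= mxE. Qed.

Lemma sum_X_dir_x i z : \sum_j X j z * X j (dir_x i) = X i z.
Proof. by under eq_bigr do rewrite X_dir_x mulrC; rewrite sum_delta. Qed.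

Lemma sum_X_dir_t z : \sum_j X j z * X j (@dir_t R n) = 0.
Proof. by rewrite big1// => j _; rewrite X_dir_t mulr0. Qed.

Lemma Dr2 i z : U z -> D i r2 z = 2 * X i z.
Proof. by move=> Uz; rewrite /D derive_r2// sum_X_dir_x. Qed.

Lemma Dtr2 z : U z -> Dt r2 z = 0.
Proof. by move=> Uz; rewrite /Dt derive_r2// sum_X_dir_t mulr0. Qed.

Lemma DN i z : U z -> D i N z = 4 * r2 z * X i z.
Proof. by move=> Uz; rewrite /D derive_N// sum_X_dir_x /T/= mulr0 addr0. Qed.

Lemma DtN z : U z -> Dt N z = 8 * T z.
Proof. by move=> Uz; rewrite /Dt derive_N// sum_X_dir_t mulr0 add0r [T dir_t]/T/= mulr1. Qed.

Lemma Dp i z : U z -> D i p z = - 2 * p z ^+ 3 * r2 z * X i z.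
Proof. by move=> Uz; rewrite /D derive_p// [X in _ * X](DN i Uz); field. Qed.

Lemma Dtp z : U z -> Dt p z = - 4 * p z ^+ 3 * T z.
Proof. by move=> Uz; rewrite /Dt derive_p// [X in _ * X](DtN Uz); field. Qed.

Lemma pt_decomp v : v = \sum_i X i v *: dir_x i + T v *: dir_t :> pt.
Proof.
have s1 m (F : 'I_m -> pt) : (\sum_i F i).1 = \sum_i (F i).1 by exact: (big_morph fst).
have s2 m (F : 'I_m -> pt) : (\sum_i F i).2 = \sum_i (F i).2 by exact: (big_morph snd).
rewrite [LHS]surjective_pairing [RHS]surjective_pairing; congr (_, _).
  rewrite /= s1 scaler0 addr0 [LHS]row_sum_delta.
  by apply: eq_bigr => i _; rewrite /X.
rewrite /= s2 big1 ?add0r; first by rewrite [RHS]mulr1.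
by move=> i _; exact: mulr0.
Qed.

Lemma derive_decomp f z v : differentiable f z ->
  'D_v f z = \sum_i X i v * D i f z + T v * Dt f z.
Proof.
move=> df; rewrite deriveE// [v in LHS]pt_decomp linearD linear_sum/= linearZ/=.
rewrite /Dt deriveE//; congr (_ + _); apply: eq_bigr => i _.
by rewrite linearZ/= /D deriveE.
Qed.

Lemma D_M i f g z : Cinf f -> Cinf g -> U z ->
  D i (fun z => f z * g z) z = D i f z * g z + f z * D i g z.
Proof. exact: DinfM. Qed.

Lemma D_D i f g z : Cinf f -> Cinf g -> U z ->
  D i (fun z => f z + g z) z = D i f z + D i g z.
Proof. exact: DinfD. Qed.

Lemma D_B i f g z : Cinf f -> Cinf g -> U z ->
  D i (fun z => f z - g z) z = D i f z - D i g z.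
Proof. exact: DinfB. Qed.

Lemma D_Z i c f z : Cinf f -> U z -> D i (fun z => c * f z) z = c * D i f z.
Proof. exact: DinfZ. Qed.

Lemma D_sum i m (F : 'I_m -> pt -> R) z : (forall j, Cinf (F j)) -> U z ->
  D i (fun z => \sum_j F j z) z = \sum_j D i (F j) z.
Proof. exact: Dinf_sum. Qed.

Lemma Dt_M f g z : Cinf f -> Cinf g -> U z ->
  Dt (fun z => f z * g z) z = Dt f z * g z + f z * Dt g z.
Proof. exact: DinfM. Qed.

Lemma Dt_D f g z : Cinf f -> Cinf g -> U z ->
  Dt (fun z => f z + g z) z = Dt f z + Dt g z.
Proof. exact: DinfD. Qed.

Lemma Dt_B f g z : Cinf f -> Cinf g -> U z ->
  Dt (fun z => f z - g z) z = Dt f z - Dt g z.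
Proof. exact: DinfB. Qed.

Lemma Dt_Z c f z : Cinf f -> U z -> Dt (fun z => c * f z) z = c * Dt f z.
Proof. exact: DinfZ. Qed.

Lemma Dt_sum m (F : 'I_m -> pt -> R) z : (forall j, Cinf (F j)) -> U z ->
  Dt (fun z => \sum_j F j z) z = \sum_j Dt (F j) z.
Proof. exact: Dinf_sum. Qed.

Lemma D_comm i j f z : Cinf f -> U z -> D i (D j f) z = D j (D i f) z.
Proof. by move=> Cf Uz; exact: (derive_comm _ _ open_punctured (Cf 1%N) Uz). Qed.

Lemma D_Dt i f z : Cinf f -> U z -> D i (Dt f) z = Dt (D i f) z.
Proof. by move=> Cf Uz; exact: (derive_comm _ _ open_punctured (Cf 1%N) Uz). Qed.

(* The generator of the dilations (x, t) -> (s x, s^2 t). *)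
Definition E f z : R := \sum_i X i z * D i f z + 2 * T z * Dt f z.

Lemma Cinf_D i f : Cinf f -> Cinf (D i f). Proof. exact: Cinf_derive. Qed.
Lemma Cinf_Dt f : Cinf f -> Cinf (Dt f). Proof. exact: Cinf_derive. Qed.

Lemma Cinf_E f : Cinf f -> Cinf (E f).
Proof.
move=> Cf; apply: CinfD.
  by apply: Cinf_sum => i; apply: CinfM; [exact: Cinf_X|exact: Cinf_D].
by apply: CinfM; [exact/CinfZ/Cinf_T|exact: Cinf_Dt].
Qed.

Lemma EM f g z : Cinf f -> Cinf g -> U z ->
  E (fun z => f z * g z) z = E f z * g z + f z * E g z.
Proof.
move=> Cf Cg Uz; rewrite /E Dt_M//.
have -> : \sum_i X i z * D i (fun z => f z * g z) z =
    (\sum_i X i z * D i f z) * g z + f z * (\sum_i X i z * D i g z).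
  rewrite mulr_suml mulr_sumr -big_split; apply: eq_bigr => i _.
  by rewrite D_M//=; ring.
by ring.
Qed.

Lemma ED f g z : Cinf f -> Cinf g -> U z ->
  E (fun z => f z + g z) z = E f z + E g z.
Proof.
move=> Cf Cg Uz; rewrite /E Dt_D//.
have -> : \sum_i X i z * D i (fun z => f z + g z) z =
    (\sum_i X i z * D i f z) + (\sum_i X i z * D i g z).
  by rewrite -big_split; apply: eq_bigr => i _; rewrite D_D//=; ring.
by ring.
Qed.

Lemma EZ c f z : Cinf f -> U z -> E (fun z => c * f z) z = c * E f z.
Proof.
move=> Cf Uz; rewrite EM//; last exact: Cinf_cst.
rewrite (_ : E _ z = 0) ?mul0r ?add0r//.
rewrite /E /Dt derive_cst mulr0 addr0 big1// => i _.
by rewrite /D derive_cst mulr0.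
Qed.

Lemma EB f g z : Cinf f -> Cinf g -> U z ->
  E (fun z => f z - g z) z = E f z - E g z.
Proof.
move=> Cf Cg Uz; rewrite /E Dt_B//.
have -> : \sum_i X i z * D i (fun z => f z - g z) z =
    (\sum_i X i z * D i f z) - (\sum_i X i z * D i g z).
  by rewrite -sumrB; apply: eq_bigr => i _; rewrite D_B//=; ring.
by ring.
Qed.

Lemma E_sum m (F : 'I_m -> pt -> R) z : (forall i, Cinf (F i)) -> U z ->
  E (fun z => \sum_i F i z) z = \sum_i E (F i) z.
Proof.
move=> CF Uz; rewrite /E Dt_sum// big_split/= mulr_sumr exchange_big/=.
congr (_ + _); apply: eq_bigr => i _.
by rewrite D_sum// mulr_sumr.
Qed.

(** Euler's identity for the dilations: [r2] is homogeneous of degree 2 and, in the next lemma, [p]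
    of degree -2. *)
Lemma Er2 z : U z -> E r2 z = 2 * r2 z.
Proof.
move=> Uz; rewrite /E Dtr2// mulr0 addr0 /r2 mulr_sumr.
by apply: eq_bigr => i _; rewrite Dr2// expr2; ring.
Qed.

Lemma Ep z : U z -> E p z = - 2 * p z.
Proof.
move=> Uz; rewrite /E Dtp//.
under eq_bigr do rewrite Dp// mulrCA -expr2.
rewrite -mulr_sumr -[\sum_i _]/(r2 z).
transitivity (- 2 * p z * (p z ^+ 2 * N z)); first by rewrite /N; ring.
by rewrite p2N// mulr1.
Qed.

(** [D i] lowers the homogeneity degree by one and [Dt] by two, whence the coefficients 1 and 2 in
    these two commutation rules. *)
Lemma DE i f z : Cinf f -> U z -> D i (E f) z = D i f z + E (D i f) z.
Proof.
move=> Cf Uz.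
have C1 j : Cinf (fun z => X j z * D j f z).
  by apply: CinfM; [exact: Cinf_X|exact: Cinf_D].
have C2 : Cinf (fun z => 2 * T z) by exact/CinfZ/Cinf_T.
have C3 : Cinf (Dt f) by exact: Cinf_Dt.
rewrite [LHS](D_D _ (Cinf_sum C1) (CinfM C2 C3) Uz) (D_sum _ C1 Uz) (D_M _ C2 C3 Uz).
rewrite (D_Z _ _ Cinf_T Uz) DT mulr0 mul0r add0r D_Dt// /E addrA; congr (_ + _).
rewrite -(sum_delta i (fun j => D j f z)) -big_split; apply: eq_bigr => j _.
by rewrite (D_M _ (Cinf_X j) (Cinf_D j Cf) Uz) DX D_comm.
Qed.

Lemma DtE f z : Cinf f -> U z -> Dt (E f) z = 2 * Dt f z + E (Dt f) z.
Proof.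
move=> Cf Uz.
have C1 j : Cinf (fun z => X j z * D j f z).
  by apply: CinfM; [exact: Cinf_X|exact: Cinf_D].
have C2 : Cinf (fun z => 2 * T z) by exact/CinfZ/Cinf_T.
have C3 : Cinf (Dt f) by exact: Cinf_Dt.
rewrite [LHS](Dt_D (Cinf_sum C1) (CinfM C2 C3) Uz) (Dt_sum C1 Uz) (Dt_M C2 C3 Uz).
rewrite (Dt_Z _ Cinf_T Uz) DtT mulr1 addrCA; congr (_ + (_ + _)).
apply: eq_bigr => j _.
by rewrite (Dt_M (Cinf_X j) (Cinf_D j Cf) Uz) DtX mul0r add0r D_Dt.
Qed.

Definition w z : R := r2 z * p z.

(* Gam f f is |grad_G f|^2 minus its radial part |x|^2 rho^-4 (E f)^2. *)
Definition Gam f g z : R :=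
  \sum_i D i f z * D i g z + r2 z * (Dt f z * Dt g z) - r2 z * p z ^+ 2 * (E f z * E g z).

Lemma Cinf_Gam f g : Cinf f -> Cinf g -> Cinf (Gam f g).
Proof.
move=> Cf Cg; apply: CinfB.
  apply: CinfD.
    by apply: Cinf_sum => i; apply: CinfM; exact: Cinf_D.
  by apply: (CinfM Cinf_r2); apply: CinfM; exact: Cinf_Dt.
apply: CinfM; first exact: CinfM Cinf_r2 (CinfX 2 Cinf_p).
by apply: CinfM; exact: Cinf_E.
Qed.

Lemma GamC f g z : Gam f g z = Gam g f z.
Proof.
rewrite /Gam (mulrC (Dt f z)) (mulrC (E f z)); congr (_ + _ - _).
by apply: eq_bigr => i _; rewrite mulrC.
Qed.

(** Each of the three terms of [Gam] lowers the degree by 2: the factor [r2] makes up for two of the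
    four degrees lost to a pair of [Dt], and [r2 * p ^+ 2] has degree -2 itself. *)
Lemma EGam f g z : Cinf f -> Cinf g -> U z ->
  E (Gam f g) z = Gam (E f) g z + Gam f (E g) z - 2 * Gam f g z.
Proof.
move=> Cf Cg Uz.
have CDD i : Cinf (fun z => D i f z * D i g z) by apply: CinfM; exact: Cinf_D.
have CTT : Cinf (fun z => Dt f z * Dt g z) by apply: CinfM; exact: Cinf_Dt.
have CEE : Cinf (fun z => E f z * E g z) by apply: CinfM; exact: Cinf_E.
have Crp : Cinf (fun z => r2 z * p z ^+ 2) by apply: CinfM (CinfX 2 Cinf_p); exact: Cinf_r2.
rewrite (EB (CinfD (Cinf_sum CDD) (CinfM Cinf_r2 CTT)) (CinfM Crp CEE) Uz).
rewrite (ED (Cinf_sum CDD) (CinfM Cinf_r2 CTT) Uz) (E_sum CDD Uz).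
rewrite (EM Cinf_r2 CTT Uz) (EM (Cinf_Dt Cf) (Cinf_Dt Cg) Uz).
rewrite (EM Crp CEE Uz) (EM (Cinf_E Cf) (Cinf_E Cg) Uz).
have -> : E (fun z => r2 z * p z ^+ 2) z = - 2 * (r2 z * p z ^+ 2).
  rewrite (EM Cinf_r2 (CinfX 2 Cinf_p) Uz).
  have -> : (fun z => p z ^+ 2) = (fun z => p z * p z).
    by apply/funext => y; rewrite expr2.
  by rewrite (EM Cinf_p Cinf_p Uz) Ep// Er2//; ring.
rewrite Er2// /Gam !DtE//.
have -> : \sum_i E (fun z => D i f z * D i g z) z =
    \sum_i D i (E f) z * D i g z + \sum_i D i f z * D i (E g) z
    - 2 * \sum_i D i f z * D i g z.
  rewrite mulr_sumr -big_split -sumrB; apply: eq_bigr => i _ /=.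
  rewrite (EM (Cinf_D i Cf) (Cinf_D i Cg) Uz) (DE _ Cf Uz) (DE _ Cg Uz).
  by move: (E (D i f) z) (E (D i g) z) (D i f z) (D i g z) => a b c d; ring.
move: (E (E f) z) (E (E g) z) (E (Dt f) z) (E (Dt g) z) => a b c d.
move: (E f z) (E g z) (Dt f z) (Dt g z) => a' b' c' d'.
by ring.
Qed.

(** [Gam _ g] is a derivation that kills radial functions, so [p] passes through it like a
    constant. *)
Lemma GamMp f g z : Cinf f -> Cinf g -> U z ->
  Gam (fun z => p z * f z) g z = p z * Gam f g z.
Proof.
move=> Cf Cg Uz; rewrite /Gam (EM Cinf_p Cf Uz) (Dt_M Cinf_p Cf Uz) Ep// Dtp//.
have -> : \sum_i D i (fun z => p z * f z) z * D i g z =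
    p z * (\sum_i D i f z * D i g z)
    - 2 * p z ^+ 3 * r2 z * f z * \sum_i X i z * D i g z.
  rewrite mulr_sumr [X in _ - X]mulr_sumr -sumrB; apply: eq_bigr => i _.
  by rewrite (D_M _ Cinf_p Cf Uz) Dp//; ring.
rewrite [E g z]/E; set S := \sum_i X i z * _; set S1 := \sum_i _.
by ring.
Qed.

Lemma GamD f g h z : Cinf f -> Cinf g -> U z ->
  Gam (fun z => f z + g z) h z = Gam f h z + Gam g h z.
Proof.
move=> Cf Cg Uz; rewrite /Gam (ED Cf Cg Uz) (Dt_D Cf Cg Uz).
have -> : \sum_i D i (fun z => f z + g z) z * D i h z =
    \sum_i D i f z * D i h z + \sum_i D i g z * D i h z.
  rewrite -big_split; apply: eq_bigr => i _.
  by rewrite (D_D _ Cf Cg Uz) mulrDl.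
by ring.
Qed.

Lemma GamZ c f h z : Cinf f -> U z ->
  Gam (fun z => c * f z) h z = c * Gam f h z.
Proof.
move=> Cf Uz; rewrite /Gam (EZ _ Cf Uz) (Dt_Z _ Cf Uz).
have -> : \sum_i D i (fun z => c * f z) z * D i h z = c * \sum_i D i f z * D i h z.
  rewrite mulr_sumr; apply: eq_bigr => i _.
  by rewrite (D_Z _ _ Cf Uz) mulrA.
by ring.
Qed.

(* Cauchy-Schwarz for the vectors (D f, |x| Dt f) and (|x| x, 2 t), the latter
   having squared length |x|^4 + 4 t^2 = p^-2. *)
Lemma Gam_ge0 f z : U z -> 0 <= Gam f f z.
Proof.
move=> Uz; rewrite /Gam.
set S := \sum_i _ * _; set b := Dt f z; set y := \sum_i X i z * D i f z.
rewrite {1 2}/E -/y -/b.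
have r20 := r2_ge0 z.
have CS : y ^+ 2 * r2 z <= r2 z ^+ 2 * S.
  have : 0 <= \sum_i (r2 z * D i f z - y * X i z) ^+ 2.
    by apply: sumr_ge0 => i _; exact: sqr_ge0.
  have -> : \sum_i (r2 z * D i f z - y * X i z) ^+ 2 =
      r2 z ^+ 2 * S - 2 * r2 z * y * y + y ^+ 2 * r2 z.
    transitivity (\sum_i (r2 z ^+ 2 * (D i f z * D i f z)
        - 2 * r2 z * y * (X i z * D i f z) + y ^+ 2 * (X i z ^+ 2))).
      by apply: eq_bigr => i _; ring.
    by rewrite big_split/= sumrB -!mulr_sumr.
  rewrite (_ : _ + _ = r2 z ^+ 2 * S - y ^+ 2 * r2 z); last by ring.
  by rewrite subr_ge0.
have p2 := p2N Uz; have p0 := p_gt0 Uz.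
(* The last summand vanishes by [p2N]; adding it makes the remaining expression proportional to
   [p z ^+ 2]. *)
rewrite (_ : _ - _ = p z ^+ 2 * (N z * S + N z * (r2 z * (b * b))
   - r2 z * ((y + 2 * T z * b) * (y + 2 * T z * b)))
   + (1 - p z ^+ 2 * N z) * (S + r2 z * (b * b))); last by ring.
rewrite p2 subrr mul0r addr0.
rewrite mulr_ge0 ?sqr_ge0// /N.
(* The general argument multiplies by [r2 z] to reach a square plus a Cauchy-Schwarz defect, so the
   axis x = 0 is treated apart. *)
have [r0|r0] := eqVneq (r2 z) 0.
  rewrite r0; have S0 : 0 <= S by apply: sumr_ge0 => i _; rewrite -expr2 sqr_ge0.
  by rewrite !mul0r mulr0 addr0 subr0 expr0n/= add0r mulr_ge0// mulr_ge0 ?sqr_ge0.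
have {}r0 : 0 < r2 z by rewrite lt_neqAle eq_sym r0.
rewrite -(pmulr_rge0 _ r0).
have {}CS : 0 <= r2 z * S - y ^+ 2.
  rewrite -(pmulr_rge0 _ r0) (_ : r2 z * (r2 z * S - _) = r2 z ^+ 2 * S - y ^+ 2 * r2 z).
    by rewrite subr_ge0.
  by ring.
have -> : r2 z * ((r2 z ^+ 2 + 4 * T z ^+ 2) * S +
      (r2 z ^+ 2 + 4 * T z ^+ 2) * (r2 z * (b * b)) -
      r2 z * ((y + 2 * T z * b) * (y + 2 * T z * b))) =
    (r2 z ^+ 2 + 4 * T z ^+ 2) * (r2 z * S - y ^+ 2) +
      (r2 z ^+ 2 * b - 2 * T z * y) ^+ 2.
  by ring.
rewrite addr_ge0 ?sqr_ge0// mulr_ge0//.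
by rewrite addr_ge0 ?sqr_ge0// mulr_ge0 ?sqr_ge0.
Qed.

(* On radial functions the Grushin operator L coincides with w A. *)
Definition A u z : R := p z * (E (E u) z + n%:R * E u z).
Definition L u z : R := \sum_i D i (D i u) z + r2 z * Dt (Dt u) z.

Lemma grushin_opE u z : grushin_op u z = L u z.
Proof. by rewrite /grushin_op enorm2. Qed.

Lemma Cinf_A u : Cinf u -> Cinf (A u).
Proof.
move=> Cu; apply: (CinfM Cinf_p); apply: CinfD; first exact/Cinf_E/Cinf_E.
exact/CinfZ/Cinf_E.
Qed.

Lemma Cinf_L u : Cinf u -> Cinf (L u).
Proof.
move=> Cu; apply: CinfD; first by apply: Cinf_sum => i; exact/Cinf_D/Cinf_D.
by apply: (CinfM Cinf_r2); exact/Cinf_Dt/Cinf_Dt.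
Qed.

Lemma Cinf_w : Cinf w. Proof. exact: CinfM Cinf_r2 Cinf_p. Qed.

(** The dilation field times [H u] has divergence [E (H u) + (n + 2) H u]. The first term of [H]
    contributes the radial part [r2 p^2 E (A u) E u] of the product of the gradients of [A u] and
    [u], plus [w (A u)^2]. The other two contribute the nonradial part [Gam (A u) u], plus the
    nonnegative remainder of [flux_identity]. *)
Definition H u z : R := r2 z * p z ^+ 2 * (A u z * E u z)
  + (p z * Gam (E u) u z + p z * Gam u u z).

(* (Fx, Ft) is A u times the field (D u, |x|^2 Dt u), minus H u times the dilation
   field (x, 2 t). *)
Definition Fx u i z : R := A u z * D i u z - X i z * H u z.
Definition Ft u z : R := r2 z * (A u z * Dt u z) - 2 * T z * H u z.

Section flux.
Variables (u : pt -> R) (Cu : Cinf u).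

Let C2 : Cinf (fun z => r2 z * p z ^+ 2).
Proof. exact: CinfM Cinf_r2 (CinfX 2 Cinf_p). Qed.

Let CAE : Cinf (fun z => A u z * E u z).
Proof. by apply: CinfM; [exact: Cinf_A|exact: Cinf_E]. Qed.

Let CG1 : Cinf (fun z => p z * Gam (E u) u z).
Proof. by apply: (CinfM Cinf_p); apply: Cinf_Gam => //; exact: Cinf_E. Qed.

Let CG0 : Cinf (fun z => p z * Gam u u z).
Proof. by apply: (CinfM Cinf_p); exact: Cinf_Gam. Qed.

Lemma Cinf_H : Cinf (H u).
Proof. by apply: CinfD; [exact: CinfM|exact: CinfD]. Qed.

Lemma Cinf_Fx i : Cinf (Fx u i).
Proof.
apply: CinfB; first by apply: CinfM; [exact: Cinf_A|exact: Cinf_D].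
by apply: CinfM; [exact: Cinf_X|exact: Cinf_H].
Qed.

Lemma Cinf_Ft : Cinf (Ft u).
Proof.
apply: CinfB.
  by apply: (CinfM Cinf_r2); apply: CinfM; [exact: Cinf_A|exact: Cinf_Dt].
by apply: CinfM; [exact/CinfZ/Cinf_T|exact: Cinf_H].
Qed.

Let EH z : U z -> E (H u) z =
  - 2 * (r2 z * p z ^+ 2) * (A u z * E u z)
  + r2 z * p z ^+ 2 * (E (A u) z * E u z + A u z * E (E u) z)
  - 2 * p z * Gam (E u) u z
  + p z * (Gam (E (E u)) u z + Gam (E u) (E u) z - 2 * Gam (E u) u z)
  - 2 * p z * Gam u u z + p z * (2 * Gam (E u) u z - 2 * Gam u u z).
Proof.
move=> Uz; have CE := Cinf_E Cu.
rewrite /H (ED (CinfM C2 CAE) (CinfD CG1 CG0) Uz) (ED CG1 CG0 Uz).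
rewrite (EM C2 CAE Uz) (EM (Cinf_A Cu) CE Uz).
rewrite (EM Cinf_p (Cinf_Gam CE Cu) Uz) (EM Cinf_p (Cinf_Gam Cu Cu) Uz).
rewrite (EGam CE Cu Uz) (EGam Cu Cu Uz) (Ep Uz) (GamC u (E u)).
have -> : E (fun z => r2 z * p z ^+ 2) z = - 2 * (r2 z * p z ^+ 2).
  rewrite (EM Cinf_r2 (CinfX 2 Cinf_p) Uz).
  have -> : (fun z => p z ^+ 2) = (fun z => p z * p z).
    by apply/funext => y; rewrite expr2.
  by rewrite (EM Cinf_p Cinf_p Uz) Ep// Er2//; ring.
move: (Gam (E (E u)) u z) (Gam (E u) (E u) z) (Gam (E u) u z) (Gam u u z) => a b c d.
by move: (E (A u) z) (E (E u) z) (A u z) (E u z) => e f g h; ring.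
Qed.

(* The coefficient n - 2 is Q - 4, hence nonnegative in the theorem. *)
Lemma flux_identity z : U z ->
  A u z * (L u z - w z * A u z) =
  (\sum_i D i (Fx u i) z + Dt (Ft u) z)
  + p z * (Gam (E u) (E u) z + (n%:R - 2) * Gam u u z).
Proof.
move=> Uz; have CE := Cinf_E Cu; have CA := Cinf_A Cu; have CH := Cinf_H.
have CD i := Cinf_D i Cu; have Ct := Cinf_Dt Cu.
have CT2 : Cinf (fun z => 2 * T z) by exact/CinfZ/Cinf_T.
have SF : \sum_i D i (Fx u i) z = \sum_i D i (A u) z * D i u z
    + A u z * (\sum_i D i (D i u) z) - n%:R * H u z - \sum_i X i z * D i (H u) z.
  transitivity (\sum_i (D i (A u) z * D i u z + A u z * D i (D i u) z
      - H u z - X i z * D i (H u) z)).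
    apply: eq_bigr => i _.
    rewrite (D_B _ (CinfM CA (CD i)) (CinfM (Cinf_X i) CH) Uz).
    rewrite (D_M _ CA (CD i) Uz) (D_M _ (Cinf_X i) CH Uz) DX eqxx (_ : true%:R = 1 :> R)//.
    by move: (D i (H u) z) (D i (D i u) z) (D i (A u) z) => a b c; ring.
  rewrite !sumrB big_split/= -mulr_sumr sumr_const card_ord mulr_natl.
  by [].
have ST : Dt (Ft u) z = r2 z * (Dt (A u) z * Dt u z + A u z * Dt (Dt u) z)
    - 2 * H u z - 2 * T z * Dt (H u) z.
  rewrite (Dt_B (CinfM Cinf_r2 (CinfM CA Ct)) (CinfM CT2 CH) Uz).
  rewrite (Dt_M Cinf_r2 (CinfM CA Ct) Uz) (Dt_M CA Ct Uz) (Dt_M CT2 CH Uz).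
  rewrite (Dt_Z _ Cinf_T Uz) DtT Dtr2//.
  by move: (Dt (H u) z) (Dt (Dt u) z) (Dt (A u) z) => a b c; ring.
have GA : Gam (A u) u z = p z * (Gam (E (E u)) u z + n%:R * Gam (E u) u z).
  rewrite (GamMp (CinfD (Cinf_E CE) (CinfZ n%:R CE)) Cu Uz).
  by rewrite (GamD _ (Cinf_E CE) (CinfZ n%:R CE) Uz) (GamZ _ _ CE Uz).
have GA' : \sum_i D i (A u) z * D i u z + r2 z * (Dt (A u) z * Dt u z) =
    r2 z * p z ^+ 2 * (E (A u) z * E u z)
    + p z * (Gam (E (E u)) u z + n%:R * Gam (E u) u z).
  by rewrite -GA [RHS]addrC subrK.
have EHz : \sum_i X i z * D i (H u) z + 2 * T z * Dt (H u) z = _ := EH Uz.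
(* Product rule for the divergence of the flux; [n + 2] is the divergence of the dilation field (x,
   2 t). *)
have key : \sum_i D i (Fx u i) z + Dt (Ft u) z =
    (\sum_i D i (A u) z * D i u z + r2 z * (Dt (A u) z * Dt u z))
    + A u z * L u z - (n%:R + 2) * H u z
    - (\sum_i X i z * D i (H u) z + 2 * T z * Dt (H u) z).
  rewrite SF ST /L.
  move: (\sum_i _ * _) (\sum_i D i (D i u) z) (\sum_i _) => a b c.
  by move: (Dt (A u) z) (Dt (Dt u) z) (Dt (H u) z) => d e f; ring.
rewrite {}key {}EHz {}GA' /H /w.
have Ae : A u z = p z * (E (E u) z + n%:R * E u z) by [].
have -> : r2 z * p z * A u z = r2 z * p z ^+ 2 * (E (E u) z + n%:R * E u z).
  by rewrite Ae; move: (E (E u) z) (E u z) => a b; ring.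
move: (Gam (E (E u)) u z) (Gam (E u) (E u) z) (Gam (E u) u z) (Gam u u z) => a b c d.
by move: (E (A u) z) (E (E u) z) (A u z) (E u z) (L u z) => e f g h k; ring.
Qed.

End flux.

End grushin_calculus.

(** * Lebesgue measure on the Grushin space *)

Section rV_measure.
Context {R : realType}.
Local Notation mu := (@lebesgue_measure R).
Local Notation mR := (measurableTypeR R).

Lemma rV_cons0 n (p : mR * 'rV[R]_n) : rV_cons p ord0 ord0 = p.1.
Proof.
rewrite /rV_cons mxE; case: splitP => [j _|j /= /eqP//].
by rewrite !ord1 !mxE.
Qed.

Lemma rV_consS n (p : mR * 'rV[R]_n) i : rV_cons p ord0 (lift ord0 i) = p.2 ord0 i.
Proof.
rewrite /rV_cons mxE; case: splitP => [j|j] /=; first by rewrite ord1.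
by move=> /eqP; rewrite eqSS => /eqP/val_inj ->.
Qed.

Lemma rV_consP n (x : 'rV[R]_n.+1) (p : mR * 'rV[R]_n) :
  x ord0 ord0 = p.1 -> (forall i, x ord0 (lift ord0 i) = p.2 ord0 i) -> x = rV_cons p.
Proof.
move=> x0 xS; apply/rowP => i; case: (unliftP ord0 i) => [j|] ->.
  by rewrite rV_consS xS.
by rewrite rV_cons0.
Qed.

Lemma rV_cons_scale n (s a : R) (y : 'rV[R]_n) :
  s *: rV_cons (a, y) = rV_cons (s * a, s *: y).
Proof.
by apply: rV_consP => [|i]; rewrite mxE ?rV_cons0 ?rV_consS//= mxE.
Qed.

Lemma measurable_coord n (i : 'I_n) :
  measurable_fun [set: 'rV[R]_n] (fun x : 'rV[R]_n => x ord0 i : mR).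
Proof. exact: measurable_coor. Qed.

Local Open Scope ereal_scope.

Lemma integral_rV_cons n (f : 'rV[R]_n.+1 -> \bar R) :
  measurable_fun setT f -> (forall x, 0 <= f x) ->
  \int[rV_lebesgue n.+1]_x f x =
  \int[mu]_a \int[rV_lebesgue n]_y f (rV_cons (a, y)).
Proof.
move=> mf f0; transitivity (\int[pushforward (mu \x rV_lebesgue n) (@rV_cons R n)]_x f x).
  exact: eq_measure_integral.
rewrite (ge0_integral_pushforward (@measurable_rV_cons R n))//.
rewrite preimage_setT (fubini_tonelli1 (f \o @rV_cons R n))//.
  by apply: measurableT_comp => //; exact: measurable_rV_cons.
by move=> q; exact: f0.
Qed.

Definition scale1 (s : R) : mR -> mR := fun x => (s * x)%R.

Lemma measurable_scale1 (s : R) : measurable_fun setT (scale1 s).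
Proof. exact: measurable_funM. Qed.

(** [s] times the image of Lebesgue measure under multiplication by [s] agrees with Lebesgue measure
    on half-open intervals, so uniqueness identifies the two. *)
Lemma lebesgue_scale (s : R) (f : mR -> \bar R) : (0 < s)%R ->
  measurable_fun setT f -> (forall x, 0 <= f x) ->
  s%:E * \int[mu]_x f (s * x)%R = \int[mu]_x f x.
Proof.
move=> s0 mf f0.
pose ns : {nonneg R} := NngNum (ltW s0).
pose m1 : {measure set mR -> \bar R} :=
  measure_function_pushforward__canonical__measure_function_Measure mu (measurable_scale1 s).
transitivity (\int[mscale ns m1]_x f x).
  rewrite ge0_integral_mscale//; congr (_ * _).
  by rewrite (ge0_integral_pushforward (@measurable_scale1 s)).
apply: eq_measure_integral => A mA _; apply/esym.
apply: lebesgue_measure_unique => //= _ [[a b]] _ <-.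
rewrite /mscale/= /pushforward.
rewrite (_ : scale1 s @^-1` _ = `]a / s, b / s]%classic)%R; last first.
  apply/seteqP; split => x /=; rewrite !in_itv/= /scale1 ltr_pdivrMr// ler_pdivlMr//.
    by rewrite ![(x * s)%R]mulrC.
  by rewrite ![(x * s)%R]mulrC.
rewrite !lebesgue_measure_itv/= !lte_fin ltr_pM2r ?invr_gt0//.
case: ifP => _; last by rewrite mule0.
by rewrite -!EFinB -EFinM -mulrBl mulrC mulfVK// gt_eqF.
Qed.

Lemma rV_lebesgue_scale n (s : R) (f : 'rV[R]_n -> \bar R) : (0 < s)%R ->
  measurable_fun setT f -> (forall x, 0 <= f x) ->
  (s ^+ n)%:E * \int[rV_lebesgue n]_x f (s *: x)%R = \int[rV_lebesgue n]_x f x.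
Proof.
move=> s0; elim: n f => [|n IH] f mf f0.
  by rewrite mul1e; apply: eq_integral => x _; congr f; apply/rowP => -[].
have mfc : measurable_fun setT (f \o @rV_cons R n).
  by apply: measurableT_comp => //; exact: measurable_rV_cons.
have msc m : measurable_fun setT (fun x : 'rV[R]_m => (s *: x)%R).
  apply: measurable_fun_rV => i.
  rewrite (_ : _ \o _ = fun x : 'rV[R]_m => (s * (x ord0 i : mR))%R); last first.
    by apply/funext => x /=; rewrite mxE.
  by apply: measurable_funM => //; exact: measurable_coord.
have mfs : measurable_fun setT (fun x : 'rV[R]_n.+1 => f (s *: x)%R).
  exact: (measurableT_comp mf (msc n.+1)).
rewrite !integral_rV_cons//.
under eq_integral => a _ do under eq_integral => y _ do rewrite rV_cons_scale.
pose h (a : mR) := \int[rV_lebesgue n]_y f (rV_cons (a, y)).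
have mh : measurable_fun setT h.
  apply: (measurable_fun_fubini_tonelli_F (m2 := rV_lebesgue n) (f \o @rV_cons R n)) => //.
  by move=> q; exact: f0.
have h0 a : 0 <= h a by exact: integral_ge0.
have -> : \int[mu]_a h a = s%:E * \int[mu]_a h (s * a)%R.
  by rewrite lebesgue_scale.
rewrite exprS EFinM -muleA; congr (_ * _).
have mhs : measurable_fun setT (fun a : mR => h (s * a)%R).
  by apply: (measurableT_comp mh); exact: measurable_funM.
have sn0 : 0 <= (s ^+ n)%:E by rewrite lee_fin exprn_ge0// ltW.
transitivity (\int[mu]_a ((s ^+ n)%:E *
   \int[rV_lebesgue n]_y f (rV_cons (s * a, s *: y))%R)); last first.
  apply: eq_integral => a _; rewrite (IH (fun y => f (rV_cons (s * a, y)%R)))//.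
  by apply: (measurableT_comp mfc); exact: measurable_pair1.
rewrite ge0_integralZl//.
  have : measurable_fun setT (fun p : mR * 'rV[R]_n => f (rV_cons (s * p.1, s *: p.2)%R)).
    apply: (measurableT_comp mfc); apply: measurable_fun_pair => /=.
      by apply: measurable_funM => //; exact: measurable_fst.
    by apply: (measurableT_comp (msc n)); exact: measurable_snd.
  by move=> /(measurable_fun_fubini_tonelli_F (m2 := rV_lebesgue n)); apply => q.
by move=> a _; exact: integral_ge0.
Qed.

Lemma rV_lebesgue_box n (a b : R) : (a < b)%R ->
  rV_lebesgue n [set x : 'rV[R]_n | forall i, a <= x ord0 i <= b]%R = ((b - a) ^+ n)%:E.
Proof.
move=> ab; elim: n => [|n IH].
  rewrite /= diracE mem_set//=; last by case.
pose B m := [set x : 'rV[R]_m | forall i, a <= x ord0 i <= b]%R.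
have mB : measurable (B n).
  rewrite (_ : B n = \bigcap_(i in [set: 'I_n])
      ((fun x : 'rV[R]_n => x ord0 i : mR) @^-1` `[a, b])).
    apply: fin_bigcap_measurable => // i _; rewrite -[X in measurable X]setTI.
    by apply: measurable_coord.
  by apply/seteqP; split => x /= H i; have := H i; rewrite /= in_itv//=; apply.
rewrite /= /rV_lebesgue_succ /pushforward.
rewrite (_ : _ @^-1` _ = `[a, b]%classic `*` B n); last first.
  apply/seteqP; split => -[c y] /=; rewrite in_itv/=.
    move=> H; split=> [|i]; first by have := H ord0; rewrite rV_cons0.
    by have := H (lift ord0 i); rewrite rV_consS.
  move=> [H1 H2] i; case: (unliftP ord0 i) => [j|] ->; last by rewrite rV_cons0.
  by rewrite rV_consS.
rewrite product_measure1E//; rewrite -/(B n) in IH.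
rewrite /= in IH *; rewrite IH lebesgue_measure_itv/= lte_fin ab.
by rewrite -EFinB -EFinM exprS.
Qed.

Lemma rV_lebesgue_hyperplane n (i : 'I_n) :
  rV_lebesgue n [set x : 'rV[R]_n | x ord0 i = 0%R] = 0.
Proof.
elim: n i => [[]//|n IH i].
have mZ m (j : 'I_m) : measurable [set x : 'rV[R]_m | x ord0 j = 0%R].
  rewrite -[X in measurable X]setTI.
  by have := @measurable_coord m j measurableT [set 0%R] (measurable_set1 _).
rewrite /= /rV_lebesgue_succ /pushforward; case: (unliftP ord0 i) => [j|] ->.
  rewrite (_ : _ @^-1` _ = setT `*` [set y : 'rV[R]_n | y ord0 j = 0%R]).
    by rewrite (product_measure1E _ _ measurableT (mZ n j)) [X in _ * X](IH j) mule0.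
  by apply/seteqP; split => -[c y] /=; rewrite rV_consS => //; case.
rewrite (_ : _ @^-1` _ = [set 0%R] `*` setT).
  by rewrite product_measure1E//= lebesgue_measure_set1 mul0e.
by apply/seteqP; split => -[c y] /=; rewrite rV_cons0 => //; case.
Qed.

End rV_measure.

(** * Derivatives of functions with bounded support integrate to zero *)

Section bounded_support.
Context {R : realType}.
Local Notation mu := (@lebesgue_measure R).
Local Notation mR := (measurableTypeR R).

Lemma integrable_bounded_support d (S : measurableType d)
    (m : {measure set S -> \bar R}) (B : set S) (f : S -> R) (M : R) :
  measurable B -> (m B < +oo)%E -> measurable_fun setT f ->
  (forall x, `|f x| <= M) -> (forall x, ~ B x -> f x = 0) ->
  m.-integrable setT (EFin \o f).
Proof.
move=> mB Boo mf fM f0.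
rewrite (_ : EFin \o f = (EFin \o f) \_ B); last first.
  apply/funext => x /=; rewrite patchE; case: ifPn => //.
  by rewrite notin_setE => /f0 ->.
apply/integrable_restrict => //; rewrite setTI.
apply: measurable_bounded_integrable => //; first exact: measurable_funTS.
exists M; split; first exact: num_real.
by move=> N MN x _ /=; rewrite (le_trans (fM x))// ltW.
Qed.

Lemma integral_derive_eq0 (F G : R -> R) (K : R) :
  (forall x : R, is_derive x 1 F (G x)) -> continuous G ->
  (forall x : R, K < `|x| -> F x = 0 /\ G x = 0) ->
  (\int[mu]_x (G x)%:E = 0)%E.
Proof.
move=> FG cG FG0; pose L : R := `|K| + 1.
(* Taking [L = |K| + 1] keeps the segment nondegenerate even for negative [K], and [F] vanishes at
   both of its ends. *)
have L0 : 0 < L by rewrite ltr_wpDl.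
have KL x : L <= `|x| -> F x = 0 /\ G x = 0.
  move=> Lx; apply: FG0; apply: lt_le_trans Lx.
  by rewrite (le_lt_trans (ler_norm K))// ltrDl.
have dF x : derivable F x 1 by have [] := FG x.
have cF : continuous F.
  by move=> x; apply/differentiable_continuous/derivable1_diffP.
transitivity (\int[mu]_(x in `[(- L)%R, L]) (G x)%:E)%E.
  rewrite [RHS]integral_mkcond; apply: eq_integral => x _.
  rewrite patchE; case: ifPn => //; rewrite notin_setE /= in_itv/= -ler_norml.
  by move=> /negP; rewrite -ltNge => /ltW/KL[_ ->].
rewrite (@continuous_FTC2 _ G F); first last.
- by move=> x _; rewrite derive1E; have [_ ->] := FG x.
- split; first by move=> x _.
    by apply: cvg_at_right_filter; exact: cF.
  by apply: cvg_at_left_filter; exact: cF.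
- exact: continuous_subspaceT.
- by rewrite gtrN.
have [-> _] := KL L (ler_norm L).
have [|-> _] := KL (- L); first by rewrite normrN ler_norm.
by rewrite subee.
Qed.

Definition rV_box n (K : R) := [set x : 'rV[R]_n | forall i, - K <= x ord0 i <= K].

Lemma measurable_rV_box n K : measurable (@rV_box n K).
Proof.
rewrite (_ : rV_box K = \bigcap_(i in [set: 'I_n])
    ((fun x : 'rV[R]_n => x ord0 i : mR) @^-1` `[- K, K])).
  apply: fin_bigcap_measurable => // i _; rewrite -[X in measurable X]setTI.
  by apply: measurable_coord.
by apply/seteqP; split => x /= H i; have := H i; rewrite /= in_itv//=; apply.
Qed.

Lemma rV_box_lty n K : (rV_lebesgue n (rV_box K) < +oo)%E.
Proof.
have K0 : 0 < `|K| + 1 by rewrite ltr_wpDl.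
apply: (@le_lt_trans _ _ (rV_lebesgue n (rV_box (`|K| + 1)))).
  rewrite le_measure ?inE//; [exact: measurable_rV_box..|].
  move=> x Kx i; rewrite -ler_norml; have := Kx i; rewrite -ler_norml => /le_trans; apply.
  by rewrite (le_trans (ler_norm K))// lerDl.
by rewrite (@rV_lebesgue_box _ n (- (`|K| + 1)))// ?ltry// gtrN.
Qed.

(** Both bounds are explicit so that the same [M] and [K] serve every slice in the induction on the
    dimension. *)
Definition bounded_support n (G : 'rV[R]_n -> R) (M K : R) :=
  (forall x, `|G x| <= M) /\ (forall x, ~ rV_box K x -> G x = 0).

Lemma bounded_support_integrable n (G : 'rV[R]_n -> R) M K :
  measurable_fun setT G -> bounded_support G M K ->
  (rV_lebesgue n).-integrable setT (EFin \o G).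
Proof.
move=> mG [GM G0]; apply: (integrable_bounded_support (B := rV_box K)) GM G0 => //.
  exact: measurable_rV_box.
exact: rV_box_lty.
Qed.

Lemma bounded_support_cons n (G : 'rV[R]_n.+1 -> R) M K a :
  bounded_support G M K -> bounded_support (fun y => G (rV_cons (a, y))) M K.
Proof.
move=> [GM G0]; split=> [y|y Ky]; first exact: GM.
by apply: G0 => H; apply: Ky => i; have := H (lift ord0 i); rewrite rV_consS.
Qed.

(** Both orders are needed: the induction keeps the first coordinate outermost, but a derivative in
    the first coordinate must be integrated along it first. *)
Lemma integral_rV_cons_fubini n (G : 'rV[R]_n.+1 -> R) M K :
  measurable_fun setT G -> bounded_support G M K ->
  (\int[rV_lebesgue n.+1]_x (G x)%:E =
   \int[mu]_a \int[rV_lebesgue n]_y (G (rV_cons (a, y)))%:E)%E /\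
  (\int[rV_lebesgue n.+1]_x (G x)%:E =
   \int[rV_lebesgue n]_y \int[mu]_a (G (rV_cons (a, y)))%:E)%E.
Proof.
move=> mG GMK; have iG := bounded_support_integrable mG GMK.
have mGc : measurable_fun setT (G \o @rV_cons R n).
  by apply: measurableT_comp => //; exact: measurable_rV_cons.
have iGc : (mu \x rV_lebesgue n)%E.-integrable setT (EFin \o (G \o @rV_cons R n)).
  have [GM G0] := GMK.
  apply: (@integrable_bounded_support _ (mR * 'rV[R]_n)%type (mu \x rV_lebesgue n)%E
    ((`[- K, K]%classic : set mR) `*` rV_box K) (G \o @rV_cons R n) M) => //.
  - by apply: measurableX => //; exact: measurable_rV_box.
  - have E := @product_measure1E _ _ mR _ R mu (rV_lebesgue n) `[- K, K]%classic
      (rV_box K) (measurable_itv _) (measurable_rV_box K).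
    rewrite [X in (X < _)%E]E; apply: lte_mul_pinfty => //; last exact: rV_box_lty.
    by rewrite /= lebesgue_measure_itv/=; case: ifP.
  - by move=> x; exact: GM.
  - move=> [a y] H /=; apply: G0 => B; apply: H; split => /=.
      by have := B ord0; rewrite rV_cons0 /= in_itv/=.
    by move=> i; have := B (lift ord0 i); rewrite rV_consS.
have E : (\int[rV_lebesgue n.+1]_x (G x)%:E =
    \int[mu \x rV_lebesgue n]_p (G (rV_cons p))%:E)%E.
  transitivity (\int[pushforward (mu \x rV_lebesgue n) (@rV_cons R n)]_x (G x)%:E)%E.
    exact: eq_measure_integral.
  have mE : measurable_fun setT (EFin \o G) by exact/measurable_EFinP.
  exact: (integral_pushforward (@measurable_rV_cons R n) mE iGc measurableT).
split; rewrite E.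
  by rewrite -(integral12_prod_meas1 iGc).
by rewrite -(integral21_prod_meas1 iGc).
Qed.

Lemma integral_rV_derive_eq0 n (F G : 'rV[R]_n -> R) (i : 'I_n) M K :
  measurable_fun setT G -> bounded_support G M K ->
  (forall x, ~ rV_box K x -> F x = 0) ->
  (forall x (s : R), is_derive s 1 (fun s : R => F (x + s *: delta_mx ord0 i))
     (G (x + s *: delta_mx ord0 i))) ->
  (forall x, continuous (fun s : R => G (x + s *: delta_mx ord0 i))) ->
  (\int[rV_lebesgue n]_x (G x)%:E = 0)%E.
Proof.
elim: n F G i => [? ? []//|n IH] F G i mG GMK F0 FG cG.
have [E1 E2] := integral_rV_cons_fubini mG GMK.
move: FG cG; case: (unliftP ord0 i) => [j|] -> FG cG.
  rewrite E1; apply: integral0_eq => a _.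
  have cE (y : 'rV[R]_n) (s : R) : rV_cons (a, y + s *: delta_mx ord0 j) =
      rV_cons (a, y) + s *: delta_mx ord0 (lift ord0 j).
    apply/esym/rV_consP => [|k]; rewrite mxE ?rV_cons0 ?rV_consS [X in _ + X]mxE mxE/=.
      by rewrite mulr0 addr0.
    by rewrite !mxE (inj_eq lift_inj).
  apply: (IH (fun y => F (rV_cons (a, y))) _ j).
  - apply: (measurableT_comp mG); apply: (measurableT_comp (@measurable_rV_cons R n)).
    exact: measurable_pair1.
  - exact: bounded_support_cons GMK.
  - by move=> y Ky; apply: F0 => H; apply: Ky => k; have := H (lift ord0 k); rewrite rV_consS.
  - by move=> y s; under eq_fun do rewrite cE; rewrite cE; exact: FG.
  - by move=> y; under eq_fun do rewrite cE; exact: cG.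
rewrite E2; apply: integral0_eq => y _.
have cE (s : R) : rV_cons (s, y) = rV_cons (0, y) + s *: delta_mx ord0 ord0.
  apply/esym/rV_consP => [|k]; rewrite mxE ?rV_cons0 ?rV_consS [X in _ + X]mxE mxE/=.
    by rewrite mulr1 add0r.
  by rewrite mulr0 addr0.
have H s : K < `|s| -> ~ rV_box K (rV_cons (s, y)).
  by move=> Ks /(_ ord0); rewrite rV_cons0/= -ler_norml leNgt Ks.
apply: (@integral_derive_eq0 (fun s => F (rV_cons (s, y))) _ K).
- move=> s; rewrite (cE s).
  rewrite (_ : (fun s => F _) = (fun s => F (rV_cons (0, y) + s *: delta_mx ord0 ord0)))//.
  by apply/funext => t; rewrite (cE t).
- rewrite (_ : (fun s => G _) = (fun s => G (rV_cons (0, y) + s *: delta_mx ord0 ord0)))//.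
  by apply/funext => t; rewrite (cE t).
- by move=> s /H Ks; split; [exact: F0|case: GMK => _; exact].
Qed.

End bounded_support.

(** * Dilations, Borel sets and integration by parts on the Grushin space *)

Section grushin_measure.
Context {R : realType} {n : nat}.
Local Notation mu := (@lebesgue_measure R).
Local Notation mR := (measurableTypeR R).
Local Notation pt := ('rV[R]_n * R)%type.
Local Notation mpt := ('rV[R]_n * mR)%type.
Local Notation gl := (@grushin_lebesgue R n).

Lemma measurable_X i : measurable_fun [set: mpt] (X i : mpt -> R).
Proof.
exact: (measurableT_comp (@measurable_coord R n i) (@measurable_fst _ _ 'rV[R]_n mR)).
Qed.

Lemma measurable_T : measurable_fun [set: mpt] (T : mpt -> R).
Proof. exact: measurable_snd. Qed.

Definition box (K : R) : set mpt := rV_box K `*` `[- K, K]%classic.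

Lemma measurable_box K : measurable (box K).
Proof. by apply: measurableX => //; exact: measurable_rV_box. Qed.

Lemma box_lty K : (gl (box K) < +oo)%E.
Proof.
have E := @product_measure1E _ _ 'rV[R]_n mR R (rV_lebesgue n) mu (rV_box K)
  `[- K, K]%classic (measurable_rV_box K) (measurable_itv _).
rewrite /box [X in (X < _)%E]E; apply: lte_mul_pinfty => //.
  by rewrite ge0_fin_numE ?rV_box_lty.
by rewrite /= lebesgue_measure_itv/=; case: ifP => // _; rewrite -EFinB ltry.
Qed.

Lemma norm_rV_ge (x : 'rV[R]_n) i : `|x ord0 i| <= `|x|.
Proof.
rewrite [leRHS]/Num.norm /= mx_normrE.
by apply: le_trans (le_bigmax _ _ (ord0, i)).
Qed.

Lemma box_norm (z : pt) K : `|z| <= K -> box K z.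
Proof.
rewrite prod_normE ge_max => /andP[z1 z2]; split => [i|] /=; last first.
  by rewrite in_itv/= -ler_norml.
by rewrite -ler_norml (le_trans _ z1)// norm_rV_ge.
Qed.

Lemma grushin_lebesgue_sigma_finite : sigma_finite setT gl.
Proof.
exists (fun k => box k%:R).
  apply/esym/seteqP; split => // z _; exists (Num.truncn `|z|).+1 => //.
  by apply: box_norm; exact/ltW/truncnS_gt.
by move=> k; split; [exact: measurable_box|exact: box_lty].
Qed.

HB.instance Definition _ := Measure_isSigmaFinite.Build _ _ _ gl grushin_lebesgue_sigma_finite.

(** Off such a hyperplane [r2] and [w] are positive, so it is the exceptional set wherever [w] is
    divided by. *)
Lemma grushin_lebesgue_hyperplane i : gl [set z | X i z = 0] = 0%E.
Proof.
pose A := [set x : 'rV[R]_n | x ord0 i = 0].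
have mA : measurable A.
  rewrite -[X in measurable X]setTI.
  by have := @measurable_coord R n i measurableT [set 0] (measurable_set1 _).
have E := @product_measure1E _ _ 'rV[R]_n mR R (rV_lebesgue n) mu A setT mA measurableT.
rewrite (_ : [set z | _] = A `*` setT); last by apply/seteqP; split => z //= [].
by rewrite [LHS]E [X in (X * _)%E](@rV_lebesgue_hyperplane R n i) mul0e.
Qed.

Local Open Scope ereal_scope.

Lemma grushin_lebesgue_tonelli (f : mpt -> \bar R) :
  measurable_fun setT f -> (forall z, 0 <= f z) ->
  \int[gl]_z f z = \int[rV_lebesgue n]_x \int[mu]_t f (x, t).
Proof. by move=> mf f0; rewrite -(fubini_tonelli1 f). Qed.

Definition dil (s : R) (z : mpt) : mpt := (s *: z.1, s ^+ 2 * z.2)%R.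

Lemma measurable_rV_scale : measurable_fun setT (fun p : mR * 'rV[R]_n => p.1 *: p.2)%R.
Proof.
apply: measurable_fun_rV => i.
rewrite (_ : _ \o _ = fun p : mR * 'rV[R]_n => (p.1 * (p.2 ord0 i : mR))%R); last first.
  by apply/funext => p /=; rewrite mxE.
apply: measurable_funM; first exact: measurable_fst.
by apply: (measurableT_comp (@measurable_coord R n i)); exact: measurable_snd.
Qed.

Lemma measurable_dil2 : measurable_fun setT (fun p : mR * mpt => dil p.1 p.2).
Proof.
apply: measurable_fun_pair => /=.
  have mp : measurable_fun setT (fun p : mR * mpt => (p.1, p.2.1)).
    apply: measurable_fun_pair; first exact: measurable_fst.
    exact: (measurableT_comp (@measurable_fst _ _ 'rV[R]_n mR) (@measurable_snd _ _ mR mpt)).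
  exact: (measurableT_comp measurable_rV_scale mp).
apply: measurable_funM.
  by apply: measurable_funX; exact: measurable_fst.
exact: (measurableT_comp (@measurable_snd _ _ 'rV[R]_n mR) (@measurable_snd _ _ mR mpt)).
Qed.

Lemma measurable_dil s : measurable_fun setT (dil s).
Proof. exact: (measurableT_comp measurable_dil2 (@measurable_pair1 _ _ mR mpt s)). Qed.

(** The [n] coordinates of x contribute s^n and t contributes s^2, which gives the exponent Q. *)
Lemma grushin_lebesgue_scale (s : R) (f : mpt -> \bar R) : (0 < s)%R ->
  measurable_fun setT f -> (forall z, 0 <= f z) ->
  (s ^+ n.+2)%:E * \int[gl]_z f (dil s z) = \int[gl]_z f z.
Proof.
move=> s0 mf f0.
have mfs : measurable_fun setT (fun z => f (dil s z)).
  exact: (measurableT_comp mf (measurable_dil s)).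
rewrite !grushin_lebesgue_tonelli//.
pose h (x : 'rV[R]_n) := \int[mu]_t f (x, t).
have mh : measurable_fun setT h.
  by apply: (measurable_fun_fubini_tonelli_F (m2 := mu) f).
have h0 x : 0 <= h x by exact: integral_ge0.
rewrite -[RHS](rV_lebesgue_scale s0 mh h0).
rewrite -addn2 exprD EFinM -muleA; congr (_ * _).
have mF : measurable_fun setT (fun x => \int[mu]_t f (dil s (x, t))).
  by apply: (measurable_fun_fubini_tonelli_F (m2 := mu) (fun z => f (dil s z))).
rewrite -ge0_integralZl//; last 2 first.
  by move=> x _; exact: integral_ge0.
  by rewrite lee_fin exprn_ge0// ltW.
apply: eq_integral => x _; rewrite /h.
rewrite -(@lebesgue_scale R (s ^+ 2) (fun t => f (s *: x, t))%R)//; first by rewrite exprn_gt0.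
by apply: (measurableT_comp mf); exact: measurable_pair1.
Qed.

Local Close Scope ereal_scope.

(** The sigma-algebra is a product, so an open set is written as the countable union of the cubes it
    contains that have rational centre and half-side 1 / (k + 1). *)
Lemma open_measurable_pt (O : set pt) : open O -> measurable (O : set mpt).
Proof.
move=> oO.
pose B (q : 'rV[rat]_n * rat * nat) : set mpt := [set z : mpt |
  (forall i, `|z.1 ord0 i - ratr (q.1.1 ord0 i)| < q.2.+1%:R^-1) /\
  `|z.2 - ratr q.1.2| < q.2.+1%:R^-1].
have mB q : measurable (B q).
  rewrite (_ : B q = (\bigcap_(i in [set: 'I_n])
      ((fun z : mpt => X i z : mR) @^-1` ball (ratr (q.1.1 ord0 i) : R) q.2.+1%:R^-1))
      `&` (T : mpt -> mR) @^-1` ball (ratr q.1.2 : R) q.2.+1%:R^-1).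
    apply: measurableI.
      apply: fin_bigcap_measurable => // i _; rewrite -[X in measurable X]setTI.
      by apply: (measurable_X i) => //; exact: measurable_ball.
    rewrite -[X in measurable X]setTI.
    by apply: measurable_T => //; exact: measurable_ball.
  apply/seteqP; split => z /=; rewrite /T /X -ball_normE /ball_/= => -[H1 H2].
    by split=> [i _|] /=; rewrite distrC.
  by split=> [i|]; rewrite distrC//; exact: H1.
rewrite (_ : O = \bigcup_q (if `[< B q `<=` O >] then B q else set0)).
  apply: countable_bigcupT_measurable; first exact: countableP.
  by move=> q; case: ifP.
apply/seteqP; split => [z Oz|z [q _]]; last by case: ifPn => // /asboolP; exact.
have /nbhs_ballP[e /= e0 eO] : nbhs z O by exact: open_nbhs_nbhs.
have [k ke] : exists k : nat, k.+1%:R^-1 < e / 2.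
  have e2 : 0 < e / 2 by rewrite divr_gt0.
  have [k _ H] := near_infty_natSinv_lt (PosNum e2); exists k.
  by apply: H; exact: leqnn.
have k0 : 0 < k.+1%:R^-1 :> R by rewrite invr_gt0.
have approx (y : R) : exists q : rat, `|y - ratr q| < k.+1%:R^-1.
  have [q] := @rat_in_itvoo R (y - k.+1%:R^-1) (y + k.+1%:R^-1) ltac:(by rewrite ltrD2l gtrN).
  rewrite in_itv/= => /andP[q1 q2]; exists q.
  rewrite ltr_distl; apply/andP; split.
    by rewrite ltrBlDr.
  by rewrite -ltrBlDr.
have [g gP] := choice approx.
pose q : 'rV[rat]_n * rat * nat := (\row_i g (z.1 ord0 i), g z.2, k).
exists q => //; rewrite ifT.
  by split=> [i|]; rewrite ?mxE; exact: gP.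
apply/asboolP => y [y1 y2]; apply: eO; split.
  split=> // i j; rewrite ord1 -ball_normE /ball_/=.
  have := y1 j; rewrite mxE => H; have := gP (z.1 ord0 j) => H'.
  rewrite -(subrKA (ratr (g (z.1 ord0 j)))) (le_lt_trans (ler_normD _ _))// [e]splitr.
  by rewrite ltrD// (lt_trans _ ke)// distrC.
rewrite -ball_normE /ball_/=.
rewrite -(subrKA (ratr (g z.2))) (le_lt_trans (ler_normD _ _))// [e]splitr.
apply: ltrD; first exact: lt_trans (gP _) ke.
by rewrite distrC (lt_trans _ ke).
Qed.

Lemma continuous_measurable_pt (f : pt -> R) : continuous f ->
  measurable_fun [set: mpt] f.
Proof.
move=> /continuousP cf; apply: (measurability _ (RGenOpens.measurableE R)).
move=> _ [_ [a [b ->] <-]]; rewrite setTI; apply: open_measurable_pt.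
exact/cf/interval_open.
Qed.

Lemma compact_box K : compact (box K : set pt).
Proof.
apply: compact_setX; last exact: segment_compact.
rewrite (_ : rV_box K = [set v : 'rV[R]_n | forall i, `[- K, K]%classic (v ord0 i)]).
  by apply: (@rV_compact _ n (fun=> `[- K, K]%classic)) => _; exact: segment_compact.
by apply/seteqP; split => x /= H i; have := H i; rewrite /= in_itv.
Qed.

Lemma box_support_bounded (f : pt -> R) (K : R) : continuous f ->
  (forall z, ~ box K z -> f z = 0) -> exists M, forall z, `|f z| <= M.
Proof.
move=> cf f0.
have [M [_ MP]] := compact_bounded (continuous_compact (continuous_subspaceT cf) (@compact_box K)).
exists (`|M| + 1) => z; have [zK|zK] := pselect (box K z); last first.
  by rewrite f0// normr0 addr_ge0.
by apply: MP; [rewrite (le_lt_trans (ler_norm M))// ltrDl|exists z].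
Qed.

Lemma integrable_box_support (f : pt -> R) (K : R) : continuous f ->
  (forall z, ~ box K z -> f z = 0) -> gl.-integrable setT (EFin \o f).
Proof.
move=> cf f0; have [M fM] := box_support_bounded cf f0.
apply: (integrable_bounded_support (B := box K)) fM f0.
- exact: measurable_box.
- exact: box_lty.
- exact: continuous_measurable_pt.
Qed.

Lemma box_section (f : pt -> R) K t : (forall z, ~ box K z -> f z = 0) ->
  forall x : 'rV[R]_n, ~ rV_box K x -> f (x, t) = 0.
Proof. by move=> f0 x xK; apply: f0 => -[]. Qed.

Lemma line_x (x : 'rV[R]_n) (t s : R) i :
  (x + s *: delta_mx ord0 i, t) = s *: dir_x i + (x, t) :> pt.
Proof. by rewrite addrC; congr (_, _); rewrite /= scaler0 add0r. Qed.

Lemma line_t (x : 'rV[R]_n) (t : R) : (x, t) = t *: dir_t + (x, 0) :> pt.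
Proof. by congr (_, _); rewrite /= ?scaler0 ?add0r// addr0 [_ *: _]mulr1. Qed.

Lemma continuous_line (f : pt -> R) (z v : pt) : continuous f ->
  continuous (fun s : R => f (s *: v + z)).
Proof.
move=> cf s; apply: (@continuous_comp _ _ _ (fun s : R => s *: v + z) f); last exact: cf.
by apply: cvgD; [exact: scalel_continuous|exact: cvg_cst].
Qed.

Lemma integral_D_eq0 (f : pt -> R) (K : R) (i : 'I_n) :
  (forall z, differentiable f z) -> continuous (D i f) ->
  (forall z, ~ box K z -> f z = 0) -> (forall z, ~ box K z -> D i f z = 0) ->
  (\int[gl]_z (D i f z)%:E = 0)%E.
Proof.
move=> df cD f0 D0.
have iD := integrable_box_support cD D0.
have [M DM] := box_support_bounded cD D0.
rewrite -(integral21_prod_meas1 iD); apply: integral0_eq => t _.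
apply: (@integral_rV_derive_eq0 R n (fun x => f (x, t)) (fun x => D i f (x, t)) i M K).
- exact: (measurableT_comp (continuous_measurable_pt cD) (@measurable_pair2 _ _ 'rV[R]_n mR t)).
- by split=> [x|]; [exact: DM|exact: box_section].
- exact: box_section.
- move=> x s; rewrite (_ : (fun s => _) = (fun s : R => f (s *: dir_x i + (x, t)))).
    by rewrite line_x; apply: is_derive_line.
  by apply/funext => s'; rewrite line_x.
- move=> x; rewrite (_ : (fun s => _) = (fun s : R => D i f (s *: dir_x i + (x, t)))).
    exact: continuous_line.
  by apply/funext => s'; rewrite line_x.
Qed.

Lemma integral_Dt_eq0 (f : pt -> R) (K : R) :
  (forall z, differentiable f z) -> continuous (Dt f) ->
  (forall z, ~ box K z -> f z = 0) -> (forall z, ~ box K z -> Dt f z = 0) ->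
  (\int[gl]_z (Dt f z)%:E = 0)%E.
Proof.
move=> df cD f0 D0.
have iD := integrable_box_support cD D0.
rewrite -(integral12_prod_meas1 iD); apply: integral0_eq => x _.
have E (g : pt -> R) : (fun t => g (x, t)) = (fun t => g (t *: dir_t + (x, 0))).
  by apply/funext => t; rewrite line_t.
apply: (@integral_derive_eq0 R (fun t => f (x, t)) (fun t => Dt f (x, t)) K).
- by move=> t; rewrite E (line_t x t); apply: is_derive_line.
- by rewrite E; exact: continuous_line.
- move=> t Kt; have H : ~ box K (x, t).
    by move=> -[_] /=; rewrite in_itv/= -ler_norml leNgt Kt.
  by split; [exact: f0|exact: D0].
Qed.

End grushin_measure.

(** * The radial part of the Grushin operator *)

Section compact_support.
Context {R : realType} {n : nat}.
Local Notation pt := ('rV[R]_n * R)%type.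
Local Notation mpt := ('rV[R]_n * measurableTypeR R)%type.
Local Notation gl := (@grushin_lebesgue R n).
Local Notation U := (@punctured R n).
Implicit Types (z v : pt) (f g u : pt -> R).

Lemma grad_rho2 z : U z -> grushin_grad_norm (@rho R n) z ^+ 2 = w z.
Proof.
move=> Uz; have N0 := N_gt0 Uz; have p0 := p_gt0 Uz.
rewrite /grushin_grad_norm /= sqr_sqrtr; last by rewrite addr_ge0// sqr_ge0.
rewrite exprMn enorm2.
have -> : enorm (\row_i 'D_(dir_x i) (@rho R n) z) ^+ 2 =
    \sum_i (rho z * (p z ^+ 2 * r2 z * X i z)) ^+ 2.
  rewrite /enorm sqr_sqrtr; last by apply: sumr_ge0 => i _; exact: sqr_ge0.
  apply: eq_bigr => i _; rewrite mxE derive_rho// [X in _ * X / 4](DN i Uz).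
  by congr (_ ^+ 2); field.
rewrite derive_rho// [X in _ * X / 4](DtN Uz).
under eq_bigr do rewrite mulrA exprMn.
rewrite -mulr_sumr -/(r2 z) /w.
have H1 := rho2p Uz; have H2 := p2N Uz.
transitivity (r2 z * p z * (rho z ^+ 2 * p z) * (p z ^+ 2 * N z)).
  by rewrite /N; field.
by rewrite H1 H2 !mulr1.
Qed.

Lemma X_neq0_punctured i z : X i z != 0 -> U z.
Proof. by move=> Xz z0; move: Xz; rewrite z0 /X /= mxE eqxx. Qed.

Lemma r2_gt0 i z : X i z != 0 -> 0 < r2 z.
Proof.
move=> Xz; rewrite lt_neqAle r2_ge0 andbT eq_sym; apply: contra Xz.
by move=> /eqP/r2_eq0 z1; rewrite /X z1 mxE.
Qed.

Lemma measurable_r2 : measurable_fun [set: mpt] (@r2 R n : mpt -> R).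
Proof.
apply: measurable_sum => i; apply: measurable_funX; exact: measurable_X.
Qed.

Lemma measurable_N : measurable_fun [set: mpt] (@N R n : mpt -> R).
Proof.
apply: measurable_funD; first by exact: (measurable_funX 2 measurable_r2).
by apply: measurable_funM => //; exact: (measurable_funX 2 measurable_T).
Qed.

Lemma measurable_p : measurable_fun [set: mpt] (@p R n : mpt -> R).
Proof. exact: (measurableT_comp (measurable_powR _) measurable_N). Qed.

Lemma measurable_w : measurable_fun [set: mpt] (@w R n : mpt -> R).
Proof. by apply: measurable_funM; [exact: measurable_r2|exact: measurable_p]. Qed.

Lemma measurable_rho : measurable_fun [set: mpt] (@rho R n : mpt -> R).
Proof.
rewrite (_ : @rho R n = powN (1 / 4)); last by apply/funext => z; exact: rhoE.
exact: (measurableT_comp (measurable_powR _) measurable_N).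
Qed.

Lemma w_ge0 z : 0 <= w z.
Proof. by rewrite mulr_ge0 ?r2_ge0 ?p_ge0. Qed.

Section fixed_support.
Variables (S : set pt) (K : R).
Hypotheses (cS : closed S) (S0 : ~ S 0) (SK : S `<=` (box K : set mpt)).

(** As [S] is closed and avoids the origin, this property passes to derivatives and products, and
    turns regularity on the punctured space into regularity everywhere. *)
Definition off f := forall z, ~ S z -> f z = 0.

Lemma off_near f z : off f -> ~ S z -> \near z, cst 0 z = f z.
Proof.
move=> f0 Sz; have : nbhs z (~` S).
  by apply: open_nbhs_nbhs; split=> //; rewrite openC.
by apply: filterS => y /f0 ->.
Qed.

Lemma off_derive f v : off f -> off ('D_v f).
Proof.
move=> f0 z Sz; rewrite -(near_eq_derive v (off_near f0 Sz)).
exact: derive_cst.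
Qed.

Lemma off_punctured f z : off f -> ~ U z -> ~ S z.
Proof. by move=> f0 /contrapT ->. Qed.

Lemma off_diff f : Cinf f -> off f -> forall z, differentiable f z.
Proof.
move=> Cf f0 z; have [Uz|Uz] := pselect (U z); first exact: Cinf_diff.
apply: differentiable_near_eq (off_near f0 _) _ => //.
exact: off_punctured Uz.
Qed.

Lemma off_continuous f : Cinf f -> off f -> continuous f.
Proof. by move=> Cf f0 z; exact/differentiable_continuous/off_diff. Qed.

Lemma offMr f g : off g -> off (fun z => f z * g z).
Proof. by move=> g0 z /g0 ->; rewrite mulr0. Qed.

Lemma offMl f g : off f -> off (fun z => f z * g z).
Proof. by move=> f0 z /f0 ->; rewrite mul0r. Qed.

Lemma offD f g : off f -> off g -> off (fun z => f z + g z).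
Proof. by move=> f0 g0 z Sz; rewrite f0// g0// addr0. Qed.

Lemma offB f g : off f -> off g -> off (fun z => f z - g z).
Proof. by move=> f0 g0 z Sz; rewrite f0// g0// subr0. Qed.

Lemma off_sum m (F : 'I_m -> pt -> R) : (forall i, off (F i)) ->
  off (fun z => \sum_i F i z).
Proof. by move=> F0 z Sz; rewrite big1// => i _; exact: F0. Qed.

Lemma off_E f : off f -> off (E f).
Proof.
move=> f0; apply: offD; last exact/offMr/off_derive.
by apply: off_sum => i; exact/offMr/off_derive.
Qed.

Lemma off_A u : off u -> off (A u).
Proof. by move=> u0; apply: offMr; apply: offD; [exact/off_E/off_E|exact/offMr/off_E]. Qed.

Lemma off_L u : off u -> off (L u).
Proof.
move=> u0; apply: offD; first by apply: off_sum => i; exact/off_derive/off_derive.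
exact/offMr/off_derive/off_derive.
Qed.

Lemma off_Gam f g : off f -> off (Gam f g).
Proof.
move=> f0; apply: offB; last exact/offMr/offMl/off_E.
apply: offD; last exact/offMr/offMl/off_derive.
by apply: off_sum => i; exact/offMl/off_derive.
Qed.

Lemma off_H u : off u -> off (H u).
Proof.
move=> u0; apply: offD; first exact/offMr/offMl/off_A.
by apply: offD; apply/offMr/off_Gam => //; exact: off_E.
Qed.

Lemma off_box f : off f -> forall z, ~ (box K : set mpt) z -> f z = 0.
Proof. by move=> f0 z Kz; apply: f0 => /SK. Qed.

Lemma off_integrable f : Cinf f -> off f -> gl.-integrable setT (EFin \o f).
Proof.
by move=> Cf f0; apply: integrable_box_support (off_box f0); exact: off_continuous.
Qed.

Lemma integral_off_D f i : Cinf f -> off f -> (\int[gl]_z (D i f z)%:E = 0)%E.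
Proof.
move=> Cf f0; apply: (integral_D_eq0 (K := K)).
- exact: off_diff.
- by apply: off_continuous; [exact: Cinf_D|exact: off_derive].
- exact: off_box.
- exact/off_box/off_derive.
Qed.

Lemma integral_off_Dt f : Cinf f -> off f -> (\int[gl]_z (Dt f z)%:E = 0)%E.
Proof.
move=> Cf f0; apply: (integral_Dt_eq0 (K := K)).
- exact: off_diff.
- by apply: off_continuous; [exact: Cinf_Dt|exact: off_derive].
- exact: off_box.
- exact/off_box/off_derive.
Qed.

Lemma integral_off_add f g : Cinf f -> off f -> Cinf g -> off g ->
  (\int[gl]_z (f z + g z)%:E = \int[gl]_z (f z)%:E + \int[gl]_z (g z)%:E)%E.
Proof.
move=> Cf f0 Cg g0; under eq_integral do rewrite EFinD.
by rewrite integralD//; exact: off_integrable.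
Qed.

Lemma integral_off_sum m (F : 'I_m -> pt -> R) : (forall i, Cinf (F i)) ->
  (forall i, off (F i)) -> (forall i, \int[gl]_z (F i z)%:E = 0)%E ->
  (\int[gl]_z (\sum_i F i z)%:E = 0)%E.
Proof.
elim: m F => [|m IH] F CF F0 I0.
  by under eq_integral do rewrite big_ord0; exact: integral0.
under eq_integral do rewrite big_ord_recl.
rewrite (integral_off_add (CF ord0) (F0 ord0) (Cinf_sum (fun i => CF (lift ord0 i)))
  (off_sum (fun i => F0 (lift ord0 i)))) I0 add0e.
by apply: IH => i; [exact: CF|exact: F0|exact: I0].
Qed.

Section main_inequality.
Variables (u : pt -> R) (n2 : (2 <= n)%N) (Cu : Cinf u) (u0 : off u).

Let h z : R := p z * (Gam (E u) (E u) z + (n%:R - 2) * Gam u u z).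
Let dv z : R := \sum_i D i (Fx u i) z + Dt (Ft u) z.
Let m z : R := A u z * (L u z - w z * A u z).

Let CFx i : Cinf (Fx u i). Proof. exact: Cinf_Fx. Qed.
Let CFt : Cinf (Ft u). Proof. exact: Cinf_Ft. Qed.

Let off_Fx i : off (Fx u i).
Proof. by apply: offB; apply: offMr; [exact: off_derive|exact: off_H]. Qed.

Let off_Ft : off (Ft u).
Proof. by apply: offB; apply: offMr; [exact/offMl/off_A|exact: off_H]. Qed.

Let Ch : Cinf h.
Proof.
have CE := Cinf_E Cu; apply: (CinfM Cinf_p); apply: CinfD.
  exact: Cinf_Gam.
by apply: CinfZ; exact: Cinf_Gam.
Qed.

Let off_h : off h.
Proof. by apply: offMr; apply: offD; [exact/off_Gam/off_E|exact/offMr/off_Gam]. Qed.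

Let Cdv : Cinf dv.
Proof.
apply: CinfD; last exact: Cinf_Dt.
by apply: Cinf_sum => i; exact: Cinf_D.
Qed.

Let off_dv : off dv.
Proof.
apply: offD; last exact: off_derive.
by apply: off_sum => i; exact: off_derive.
Qed.

Let m_ge0 : (0 <= \int[gl]_z (m z)%:E)%E.
Proof.
(* [flux_identity] says nothing at the origin, but both sides vanish there. *)
have mE z : m z = dv z + h z.
  have [Uz|Uz] := pselect (U z); first exact: flux_identity.
  have Sz := off_punctured u0 Uz.
  by rewrite /m (off_A u0 Sz) mul0r off_dv// off_h// addr0.
under eq_integral do rewrite mE.
rewrite (integral_off_add Cdv off_dv Ch off_h).
rewrite (_ : \int[gl]_z (dv z)%:E = 0)%E ?add0e; last first.
  rewrite (integral_off_add (Cinf_sum (fun i => Cinf_D i (CFx i)))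
    (off_sum (fun i => off_derive _ (@off_Fx i))) (Cinf_Dt CFt) (off_derive _ off_Ft)).
  rewrite (integral_off_Dt CFt off_Ft) adde0 integral_off_sum//.
  - by move=> i; exact: Cinf_D.
  - by move=> i; exact: off_derive.
  - by move=> i; exact: integral_off_D.
apply: integral_ge0 => z _; rewrite lee_fin.
have [Uz|Uz] := pselect (U z); last by rewrite (off_h (off_punctured u0 Uz)).
rewrite mulr_ge0// ?p_ge0// addr_ge0 ?Gam_ge0//.
by rewrite mulr_ge0 ?Gam_ge0// subr_ge0 ler_nat.
Qed.

Lemma integral_radial_part_le :
  (\int[gl]_z (w z * A u z ^+ 2)%:E <= \int[gl]_z (L u z ^+ 2 / w z)%:E)%E.
Proof.
(* [m2] equals [2 A u L u - w (A u)^2], and [L u ^+ 2 / w - m2] is the square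
   [(L u - w A u)^2 / w]. *)
pose wA z := w z * A u z ^+ 2; pose m2 z := 2 * m z + wA z.
have CA := Cinf_A Cu; have CL := Cinf_L Cu; have offA := off_A u0.
have Cm : Cinf m by apply: (CinfM CA); apply: (CinfB CL); exact: (CinfM Cinf_w).
have off_m : off m by exact: offMl.
have CwA : Cinf wA by apply: (CinfM Cinf_w); exact: CinfX.
have off_wA : off wA by move=> z /offA Az; rewrite /wA Az expr0n mulr0.
have Cm2 : Cinf m2 by apply: CinfD => //; exact: CinfZ.
have off_m2 : off m2 by apply: offD => //; exact: offMr.
have mL : measurable_fun [set: mpt] (L u).
  by apply: continuous_measurable_pt; apply: off_continuous => //; exact: off_L.
have mf : measurable_fun [set: mpt] (fun z => L u z ^+ 2 / w z).
  apply: measurable_funM; first exact: measurable_funX.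
  rewrite (_ : (fun z => (w z)^-1) = (fun z => w z `^ (-1))).
    exact: (measurableT_comp (measurable_powR _) measurable_w).
  by apply/funext => z; rewrite powR_inv1// w_ge0.
have mEf : measurable_fun [set: mpt] (fun z => (L u z ^+ 2 / w z)%:E).
  exact/measurable_EFinP.
have mEm2 : measurable_fun [set: mpt] (EFin \o m2).
  exact: measurable_int (off_integrable Cm2 off_m2).
apply: (@le_trans _ _ (\int[gl]_z (m2 z)%:E)%E).
  rewrite (integral_off_add (CinfZ 2 Cm) (offMr _ off_m) CwA off_wA) leeDr//.
  under eq_integral do rewrite EFinM.
  by rewrite integralZl//; [apply: mule_ge0|exact: off_integrable].
(* [L u ^+ 2 / w] may have infinite integral, since 1 / w blows up on x = 0; comparing it with the
   positive part of [m2] only requires monotonicity for nonnegative functions. *)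
rewrite integralE (@le_trans _ _ (\int[gl]_z (EFin \o m2)^\+ z)%E)//.
  rewrite leeBlDr ?leeDl ?integral_ge0//.
  by apply: integrable_neg_fin_num => //; exact: off_integrable.
have i0 : 'I_n by exact: (Ordinal (ltnW n2)).
apply: ae_ge0_le_integral => //.
- exact: measurable_funepos.
- by move=> z _; rewrite lee_fin divr_ge0 ?sqr_ge0 ?w_ge0.
exists [set z : mpt | X i0 z = 0]; split.
- rewrite -[X in measurable X]setTI.
  by have := measurable_X i0 measurableT (measurable_set1 0).
- exact: grushin_lebesgue_hyperplane.
move=> z /= /not_implyP[_] H; apply: contrapT => /eqP Xz; apply: H.
have Uz := X_neq0_punctured Xz.
have w0 : 0 < w z by rewrite mulr_gt0 ?p_gt0 ?(r2_gt0 Xz).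
rewrite funeposE /= ge_max !lee_fin divr_ge0 ?sqr_ge0 ?w_ge0// andbT.
rewrite -subr_ge0 (_ : _ - _ = (L u z - w z * A u z) ^+ 2 / w z).
  by rewrite divr_ge0 ?sqr_ge0 ?w_ge0.
by rewrite /m2 /wA /m; field; rewrite gt_eqF.
Qed.

End main_inequality.
End fixed_support.

Lemma integral_radial_part_le_rellich_lhs (r : \bar R) u :
  Cc_smooth (grushin_ball r `\ 0) u -> (2 <= n)%N ->
  (\int[gl]_z (w z * A u z ^+ 2)%:E <= rellich_lhs r u)%E.
Proof.
move=> [su cS SA] n2; set S := closure _ in cS SA.
have u0 : off S u.
  by move=> z Sz; apply/eqP/negPn/negP => uz; apply: Sz; exact: subset_closure.
have clS : closed S by exact: closed_closure.
have S0 : ~ S 0 by move=> /SA[_]; apply.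
have [K SK] : exists K, S `<=` (box K : set mpt).
  have [M [_ MP]] := compact_bounded cS; exists (`|M| + 1) => z Sz.
  by apply/box_norm/(MP (`|M| + 1)) => //; rewrite (le_lt_trans (ler_norm M))// ltrDl.
have H := integral_radial_part_le clS S0 SK n2 (smooth_Cinf su) u0.
apply: le_trans H _; rewrite /rellich_lhs [leRHS]integral_mkcond le_eqVlt; apply/orP; left.
apply/eqP; apply: eq_integral => z _; rewrite patchE grushin_opE.
have [Sz|Sz] := pselect (S z); last first.
  by rewrite (off_L clS u0 Sz) expr0n/= !mul0r; case: ifP.
have [Bz Uz] := SA _ Sz; rewrite mem_set// grad_rho2//.
Qed.

End compact_support.

(** * Averaging over dilation orbits *)

Section radialization.
Context {R : realType} {n : nat}.
Local Notation pt := ('rV[R]_n * R)%type.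
Local Notation mpt := ('rV[R]_n * measurableTypeR R)%type.
Local Notation gl := (@grushin_lebesgue R n).
Local Notation U := (@punctured R n).
Implicit Types (z v y : pt) (f g u : pt -> R).

Lemma r2_dil s z : r2 (dil s z) = s ^+ 2 * r2 z.
Proof. by rewrite /r2 mulr_sumr; apply: eq_bigr => i _; rewrite /X /= mxE exprMn. Qed.

Lemma N_dil s z : N (dil s z) = s ^+ 4 * N z.
Proof. by rewrite /N r2_dil [T (dil s z)]/T /= -/(T z); ring. Qed.

Lemma rho_ge0 z : 0 <= rho z.
Proof. by rewrite rhoE powR_ge0. Qed.

Lemma rho4 z : rho z ^+ 4 = N z.
Proof.
rewrite rhoE -powR_mulrn ?powR_ge0// -powRrM mul1r mulVf ?pnatr_eq0//.
by rewrite powRr1// N_ge0.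
Qed.

Lemma rho_eq z y : N z = N y -> rho z = rho y.
Proof. by rewrite !rhoE => ->. Qed.

Lemma rho_dil s z : 0 <= s -> rho (dil s z) = s * rho z.
Proof.
move=> s0; apply: (@pexpIrn _ 4) => //; rewrite ?nnegrE ?mulr_ge0 ?rho_ge0//.
by rewrite exprMn !rho4 N_dil.
Qed.

Lemma rho0 : rho (0 : pt) = 0.
Proof.
have : rho (0 : pt) ^+ 4 = 0.
  rewrite rho4 /N /T /= [r2 0]big1 ?expr0n ?mulr0 ?addr0//.
  by move=> i _; rewrite /X /= mxE expr0n.
by move=> /eqP; rewrite expf_eq0 /= => /eqP.
Qed.

Lemma w0 : w (0 : pt) = 0.
Proof. by rewrite /w [r2 0]big1 ?mul0r// => i _; rewrite /X /= mxE expr0n. Qed.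

Lemma rho_neq0 z : rho z != 0 -> U z.
Proof. by move=> z0 zE; move: z0; rewrite zE rho0 eqxx. Qed.

Lemma dil_punctured s z : 0 < s -> U z -> U (dil s z).
Proof. by move=> s0 Uz; apply: rho_neq0; rewrite rho_dil ?ltW// gt_eqF// mulr_gt0// rho_gt0. Qed.

Lemma p_rho z : U z -> p z = (rho z ^+ 2)^-1.
Proof.
move=> Uz; have r0 := rho_gt0 Uz; have H := rho2p Uz.
by rewrite -[RHS]mulr1 -H mulKf// expf_neq0// gt_eqF.
Qed.

Lemma w_dil s z : 0 < s -> w (dil s z) = w z.
Proof.
move=> s0; have [Uz|/contrapT ->] := pselect (U z); last first.
  have r20 : r2 (0 : pt) = 0 by rewrite /r2 big1// => i _; rewrite /X /= mxE expr0n.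
  by rewrite /w r2_dil r20 mulr0 !mul0r.
rewrite /w r2_dil (p_rho Uz) (p_rho (dil_punctured s0 Uz)) rho_dil ?ltW//.
by field; rewrite ?gt_eqF ?rho_gt0.
Qed.

(* As a function of y, u (ray z y) is the radial function that agrees with u on
   the dilation orbit of z. *)
Definition ray z y : pt := dil (rho y / rho z) z.

Section fixed_ray.
Variables (z : pt) (Uz : U z).
Let rz : 0 < rho z := rho_gt0 Uz.

Lemma rho_ray y : rho (ray z y) = rho y.
Proof. by rewrite rho_dil ?divr_ge0 ?rho_ge0// mulfVK// gt_eqF. Qed.

Lemma ray_punctured y : U y -> U (ray z y).
Proof. by move=> Uy; apply: rho_neq0; rewrite rho_ray gt_eqF// rho_gt0. Qed.

(* The logarithmic derivative of rho in the direction v. *)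
Definition ell v y : R := p y ^+ 2 * 'D_v (@N R n) y / 4.

Lemma Cinf_ell v : Cinf (ell v).
Proof.
have C4 : Cinf (cst (4^-1) : pt -> R) by exact: Cinf_cst.
by apply: (CinfM _ C4); apply: CinfM; [exact: CinfX Cinf_p|exact: Cinf_derive Cinf_N].
Qed.

(** [ray z] takes its values in a single dilation orbit, so its differential in the direction [v] is
    [ell v y] times the dilation field (x, 2 t) at [ray z y]. *)
Lemma derive_ray f y v : Cinf f -> U y ->
  differentiable (f \o ray z) y /\ 'D_v (f \o ray z) y = E f (ray z y) * ell v y.
Proof.
move=> Cf Uy; pose s y := rho y / rho z.
have Cs : Cinf s by exact: (CinfM Cinf_rho (Cinf_cst (rho z)^-1)).
have ds : differentiable s y by exact: Cinf_diff.
have Ds : 'D_v s y = s y * ell v y.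
  rewrite (DinfM _ Cinf_rho (Cinf_cst (rho z)^-1) Uy) derive_cst mulr0 addr0 derive_rho//.
  rewrite /s /ell /cst; move: ('D_v _ y) (rho y) (rho z)^-1 (p y) => a b c d; ring.
have ds2 : differentiable (fun y => s y ^+ 2 * T z) y.
  by apply: Cinf_diff => //; exact: (CinfM (CinfX 2 Cs) (Cinf_cst (T z))).
have dr : differentiable (ray z) y.
  by apply: differentiable_pair => //; exact: differentiableZl.
have df : differentiable f (ray z y) by apply: Cinf_diff => //; exact: ray_punctured.
split; first exact: differentiable_comp.
have dX i : X i ('d (ray z) y v) = X i (ray z y) * ell v y.
  have [dXi _] := diff_X i (ray z y) 0.
  have dc : differentiable (X i \o ray z) y by exact: differentiable_comp.
  transitivity ('D_v (X i \o ray z) y).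
    rewrite (deriveE _ dc) diff_comp//= -(deriveE _ dXi).
    by have [_ ->] := diff_X i (ray z y) ('d (ray z) y v).
  rewrite (_ : X i \o ray z = fun y => s y * X i z); last first.
    by apply/funext => y'; rewrite /X /= mxE.
  rewrite (DinfM _ Cs (Cinf_cst (X i z)) Uy) derive_cst mulr0 addr0 Ds.
  by rewrite /cst /X /= mxE -/(X i z) /s; ring.
have dT : T ('d (ray z) y v) = 2 * T (ray z y) * ell v y.
  have [dTi _] := diff_T (ray z y) 0.
  have dc : differentiable (@T R n \o ray z) y by exact: differentiable_comp.
  transitivity ('D_v (@T R n \o ray z) y).
    rewrite (deriveE _ dc) diff_comp//= -(deriveE _ dTi).
    by have [_ ->] := diff_T (ray z y) ('d (ray z) y v).
  rewrite (_ : @T R n \o ray z = fun y => s y ^+ 2 * T z)//.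
  rewrite (DinfM _ (CinfX 2 Cs) (Cinf_cst (T z)) Uy) derive_cst mulr0 addr0 DinfX2// Ds.
  by rewrite /cst [T (ray z y)]/T /= -/(T z) /s; ring.
have dc : differentiable (f \o ray z) y by exact: differentiable_comp.
rewrite (deriveE _ dc) diff_comp//= -(deriveE _ df) (derive_decomp _ df) dT.
under eq_bigr do rewrite dX mulrAC.
by rewrite -mulr_suml /E; ring.
Qed.

Lemma Cinf_ray f : Cinf f -> Cinf (f \o ray z).
Proof.
move=> Cf k; elim: k f Cf => [|k IH] f Cf; split=> //.
- by move=> y Uy; have [] := derive_ray 0 Cf Uy.
- by move=> y Uy; have [] := derive_ray 0 Cf Uy.
move=> v; have H := CkM open_punctured (IH _ (Cinf_E Cf)) (Cinf_ell v k).
apply: Ck_eq_on H => [|y /set_mem Uy]; first exact: open_punctured.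
by have [_ ->] := derive_ray v Cf Uy.
Qed.

(** After two uses of [derive_ray], [E (E u)] is multiplied by the squared Grushin gradient of log
    rho, which is [w p], and [E u] by the Grushin operator applied to log rho, which is [n w p];
    moreover [p] has the same value at [y] and [ray z y]. *)
Lemma L_ray u y : Cinf u -> U y -> L (u \o ray z) y = w y * A u (ray z y).
Proof.
move=> Cu Uy; have CE := Cinf_E Cu.
have ell_x i : {in U, ell (dir_x i) =1 fun y => p y ^+ 2 * r2 y * X i y}.
  by move=> y' /set_mem Uy'; rewrite /ell [X in _ * X / 4](DN i Uy'); field.
have ell_t : {in U, ell dir_t =1 fun y => 2 * p y ^+ 2 * T y}.
  by move=> y' /set_mem Uy'; rewrite /ell [X in _ * X / 4](DtN Uy'); field.
have D1 v y' : U y' -> 'D_v (u \o ray z) y' = (E u \o ray z) y' * ell v y'.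
  by move=> Uy'; have [_ ->] := derive_ray v Cu Uy'.
have D2 v : 'D_v ('D_v (u \o ray z)) y =
    E (E u) (ray z y) * ell v y ^+ 2 + E u (ray z y) * 'D_v (ell v) y.
  rewrite (derive_eq_on open_punctured (g := fun y => (E u \o ray z) y * ell v y))//; last first.
    by move=> y' /set_mem; exact: D1.
  rewrite (DinfM _ (Cinf_ray CE) (Cinf_ell v) Uy).
  by have [_ ->] := derive_ray v CE Uy; rewrite /= expr2 mulrA.
have Cp2 : Cinf (fun y : pt => p y ^+ 2) := CinfX 2 Cinf_p.
have Dell i : 'D_(dir_x i) (ell (dir_x i)) y =
    2 * p y * (- 2 * p y ^+ 3 * r2 y * X i y) * (r2 y * X i y)
    + p y ^+ 2 * (2 * X i y * X i y + r2 y).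
  rewrite (derive_eq_on open_punctured _ (ell_x i) Uy).
  rewrite (DinfM _ (CinfM Cp2 Cinf_r2) (Cinf_X i) Uy) (DinfM _ Cp2 Cinf_r2 Uy).
  rewrite (DinfX2 _ Cinf_p Uy) -/(D i p y) -/(D i (@r2 R n) y) -/(D i (X i) y).
  rewrite Dp// Dr2// DX eqxx (_ : true%:R = 1 :> R)//; ring.
have Dellt : 'D_dir_t (ell dir_t) y =
    4 * p y * (- 4 * p y ^+ 3 * T y) * T y + 2 * p y ^+ 2.
  rewrite (derive_eq_on open_punctured _ ell_t Uy).
  rewrite (DinfM _ (CinfZ 2 Cp2) Cinf_T Uy) (DinfZ _ _ Cp2 Uy) (DinfX2 _ Cinf_p Uy).
  by rewrite -/(Dt p y) -/(Dt (@T R n) y) Dtp// DtT; ring.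
have pr : p (ray z y) = p y.
  by rewrite (p_rho Uy) (p_rho (ray_punctured Uy)) rho_ray.
rewrite /L /A pr [Dt _ _]D2 Dellt (ell_t y (mem_set Uy)).
transitivity (\sum_i (E (E u) (ray z y) * (p y ^+ 4 * r2 y ^+ 2) * X i y ^+ 2
    + E u (ray z y) * (- 4 * p y ^+ 4 * r2 y ^+ 2 + 2 * p y ^+ 2) * X i y ^+ 2
    + E u (ray z y) * p y ^+ 2 * r2 y)
  + r2 y * (E (E u) (ray z y) * (2 * p y ^+ 2 * T y) ^+ 2
    + E u (ray z y) * (4 * p y * (- 4 * p y ^+ 3 * T y) * T y + 2 * p y ^+ 2))).
  congr (_ + _); apply: eq_bigr => i _.
  rewrite [D i _ _]D2 Dell (ell_x i y (mem_set Uy)).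
  by move: (E (E u) _) (E u _) => a b; ring.
rewrite !big_split/= -!mulr_sumr -/(r2 y) sumr_const card_ord -mulr_natl.
have H := p2N Uy; rewrite /w.
move: (E (E u) _) (E u _) => a b.
transitivity (r2 y * p y ^+ 2 * (p y ^+ 2 * N y) * a
   + b * (r2 y * p y ^+ 2) * (n%:R + 4 - 4 * (p y ^+ 2 * N y))); first by rewrite /N; ring.
by rewrite H; ring.
Qed.

Lemma N_continuous : continuous (@N R n).
Proof.
have cM (f g : pt -> R) : continuous f -> continuous g -> continuous (fun z => f z * g z).
  by move=> cf cg x; apply: cvgM; [exact: cf|exact: cg].
have cr2 : continuous (@r2 R n).
  rewrite (_ : @r2 R n = fun z => \sum_(i <- index_enum 'I_n) X i z * X i z); last first.
    by apply/funext => x; apply: eq_bigr => i _; rewrite expr2.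
  elim: (index_enum _) => [|i s IH].
    by under eq_fun do rewrite big_nil; exact: cst_continuous.
  under eq_fun do rewrite big_cons.
  by move=> x; apply: cvgD; [apply: cM; exact: X_continuous|exact: IH].
rewrite (_ : @N R n = fun z => r2 z * r2 z + 4 * (T z * T z)); last first.
  by apply/funext => x; rewrite /N !expr2.
move=> x; apply: cvgD; first exact: cM.
by apply: (cM (cst 4)); [exact: cst_continuous|apply: cM; exact: T_continuous].
Qed.

(** Boundedness of the sublevel sets of [rho]. The [+ 1] makes a bound on a square also bound the
    number itself, whether or not it exceeds 1. *)
Lemma N_box y M : N y <= M -> box (M + 1) y.
Proof.
move=> yM; have M0 : 0 <= M := le_trans (N_ge0 y) yM.
have sq (a : R) : a ^+ 2 <= M + 1 -> - (M + 1) <= a <= M + 1.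
  move=> aM; rewrite -ler_norml; have [a1|a1] := leP `|a| 1.
    by rewrite (le_trans a1)// lerDr.
  rewrite (le_trans _ aM)// -real_normK ?num_real// expr2 ler_peMr ?ltW//.
  by rewrite (lt_trans _ a1).
split => [i|] /=.
  apply: sq; apply: (@le_trans _ _ (r2 y)).
    by rewrite /r2 (bigD1 i)//= lerDl sumr_ge0// => j _; exact: sqr_ge0.
  have H : r2 y ^+ 2 <= M by apply: le_trans yM; rewrite /N lerDl mulr_ge0 ?sqr_ge0.
  have [a1|a1] := leP (r2 y) 1; first by rewrite (le_trans a1)// lerDr.
  rewrite (le_trans _ (le_trans H _)) ?lerDl// expr2 ler_peMr ?ltW//.
  by rewrite (lt_trans _ a1).
rewrite in_itv/=; apply: sq; rewrite -[y.2]/(T y).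
have : 4 * T y ^+ 2 <= M by apply: le_trans yM; rewrite /N lerDr sqr_ge0.
have := sqr_ge0 (T y); lra.
Qed.

Section test_function.
Variables (r : \bar R) (u : pt -> R).
Hypothesis Cu : Cc_smooth (grushin_ball r `\ 0) u.

Let S : set pt := closure [set y | u y != 0].
Let v := u \o ray z.
Let Sv : set pt := closure [set y | v y != 0].

Let offu : off S u.
Proof. by move=> y Sy; apply/eqP/negPn/negP => uy; apply: Sy; exact: subset_closure. Qed.

Let offv : off Sv v.
Proof. by move=> y Sy; apply/eqP/negPn/negP => uy; apply: Sy; exact: subset_closure. Qed.

Let cNS : compact (@N R n @` S).
Proof.
have [_ cS _] := Cu; apply: continuous_compact => //.
exact/continuous_subspaceT/N_continuous.
Qed.

Let SvN y : Sv y -> exists2 y', S y' & rho y' = rho y.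
Proof.
have clP : closed (@N R n @^-1` (@N R n @` S)).
  apply: closed_comp; first by move=> x _; exact: N_continuous.
  by apply: compact_closed => //; exact: Rhausdorff.
move=> Sy; have : (@N R n @^-1` (@N R n @` S)) y.
  rewrite [X in X y]((closure_id _).1 clP); apply: closure_subset Sy => x /= vx.
  exists (ray z x); first exact: subset_closure.
  by rewrite -!rho4 rho_ray.
by move=> [y' Sy' yy']; exists y' => //; exact: rho_eq.
Qed.

Let Sv_ball : Sv `<=` grushin_ball r `\ 0.
Proof.
move=> y /SvN[y' Sy' yy']; have [_ _ SA] := Cu; have [By' Uy'] := SA _ Sy'.
split; first by rewrite /grushin_ball /= -yy'.
by apply: rho_neq0; rewrite -yy' gt_eqF// rho_gt0.
Qed.

Let closed_Sv : closed Sv. Proof. exact: closed_closure. Qed.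
Let Sv0 : ~ Sv 0. Proof. by move=> /Sv_ball[_]; apply. Qed.

(** Vanishing near the origin removes the only possible singularity. *)
Lemma off_Ck (S' : set pt) f : closed S' -> ~ S' 0 -> Cinf f -> off S' f -> forall k, Ck setT k f.
Proof.
move=> clS' S'0 Cf f0 k; elim: k f Cf f0 => [|k IH] f Cf f0; split=> //.
- by move=> y _; exact: (off_diff clS').
- by move=> y _; exact: (off_diff clS').
- by move=> a; apply: IH; [exact: Cinf_derive|exact: off_derive].
Qed.

Lemma Cc_smooth_ray : Cc_smooth (grushin_ball r `\ 0) v.
Proof.
have [su _ _] := Cu; split.
- apply: Ck_smooth; apply: (off_Ck closed_Sv Sv0 _ offv).
  exact/Cinf_ray/smooth_Cinf.
- have [M [_ MP]] := compact_bounded cNS.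
  apply: (subclosed_compact closed_Sv (@compact_box R n (`|M| + 1 + 1))).
  move=> y /SvN[y' Sy' yy']; apply: N_box.
  rewrite -rho4 -yy' rho4 (le_trans (ler_norm _))//.
  by apply: (MP (`|M| + 1)); [rewrite (le_lt_trans (ler_norm M))// ltrDl|exists y'].
- exact: Sv_ball.
Qed.

Lemma radial_ray : grushin_radial v.
Proof. by exists (fun s => u (dil (s / rho z) z)). Qed.

Lemma rellich_lhs_ray :
  rellich_lhs r v = (\int[gl]_y (w y * A u (ray z y) ^+ 2)%:E)%E.
Proof.
have [su _ SA] := Cu; have Ciu := smooth_Cinf su.
have clS : closed S by exact: closed_closure.
rewrite /rellich_lhs integral_mkcond; apply: eq_integral => y _.
rewrite patchE grushin_opE; have [Uy|/contrapT ->] := pselect (U y); last first.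
  by rewrite w0 mul0r (off_L closed_Sv offv Sv0) expr0n/= mul0r; case: ifP.
case: ifPn => [/set_mem By|/negP By].
  (* Where [w] vanishes both sides are 0, the left one thanks to the factor [w] produced by [L_ray];
     elsewhere w^2 / w simplifies. *)
  rewrite L_ray// grad_rho2//; have [->|w0] := eqVneq (w y) 0.
    by rewrite !mul0r expr0n/= mul0r.
  by congr EFin; field.
rewrite (off_A clS offu) ?expr0n ?mulr0//.
move=> /SA[/= + _]; rewrite /grushin_ball /= rho_ray => By'.
by apply: By; rewrite inE.
Qed.

End test_function.
End fixed_ray.
End radialization.

(** * Null sets and differences of infinite integrals *)

Section almost_everywhere.
Local Open Scope ereal_scope.
Import HBNNSimple.

(* W is arbitrary, so the integrands are in general only measurable for the
   completed measure; the integral is a supremum over simple functions below the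
   integrand, and those may be cut off to vanish on N. *)
Lemma integral_eq_off_null d (S : measurableType d) (R : realType)
    (mu : {measure set S -> \bar R}) (N : set S) (f g : S -> \bar R) :
  measurable N -> mu N = 0 -> (forall x, 0 <= f x) -> (forall x, 0 <= g x) ->
  (forall x, ~ N x -> f x = g x) -> \int[mu]_x f x = \int[mu]_x g x.
Proof.
move=> mN N0; wlog suff H : f g / (forall x, 0 <= f x) -> (forall x, 0 <= g x) ->
    (forall x, ~ N x -> f x = g x) -> \int[mu]_x f x <= \int[mu]_x g x.
  move=> f0 g0 fg; apply/eqP; rewrite eq_le; apply/andP; split; first exact: H.
  by apply: H => // x Nx; rewrite fg.
move=> f0 g0 fg; rewrite ge0_integralTE// [leRHS]ge0_integralTE//.
apply: ge_ereal_sup => _ [h /= hf <-].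
have mNC : measurable (~` N) by exact: measurableC.
pose h' := proj_nnsfun h mNC.
have -> : sintegral mu h = sintegral mu h'.
  rewrite -!integralT_nnsfun; apply: ge0_ae_eq_integral => //.
  - exact/measurable_EFinP.
  - exact/measurable_EFinP.
  - by move=> x _; rewrite lee_fin fun_ge0.
  - by move=> x _; rewrite lee_fin; exact: fun_ge0.
  exists N; split=> // x /= /not_implyP[_]; apply: contra_notP => Nx.
  by rewrite /h' /= mindicE mem_set// mulr1.
apply: ereal_sup_ubound; exists h' => //= x; rewrite mindicE.
have [Nx|Nx] := pselect (N x); last by rewrite mem_set//= mulr1 -fg.
by rewrite memNset ?mulr0//= => /(_ Nx).
Qed.

(** The integral of a negative part may be infinite. This lemma and the next carry it across an
    inequality also for [b = +oo], where [a - b] is [-oo] by convention. *)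
Lemma leB_leD (R : realType) (a b c : \bar R) : 0 <= b -> 0 <= c ->
  a - b <= c -> a <= c + b.
Proof.
case: b => [b| |] b0 c0; [by rewrite leeBlDr| |by []].
by move=> _; rewrite addey ?leey//; apply/eqP => c_; rewrite c_ in c0.
Qed.

Lemma leD_leB (R : realType) (a b c : \bar R) : 0 <= b -> a <= c + b -> a - b <= c.
Proof.
case: b => [b| |] b0; [by rewrite leeBlDr| |by []].
by move=> _; rewrite /= addeNy leNye.
Qed.

End almost_everywhere.

(** * The averaging identity over dilation orbits and its constant *)

Section polar.
Context {R : realType} {n : nat}.
Local Notation pt := ('rV[R]_n * R)%type.
Local Notation mpt := ('rV[R]_n * measurableTypeR R)%type.
Local Notation gl := (@grushin_lebesgue R n).
Local Notation U := (@punctured R n).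
Implicit Types (z y : mpt).

Lemma grushin_lebesgue_scaleR (s : R) (f : mpt -> R) : 0 < s -> measurable_fun setT f ->
  (forall z, 0 <= f z) ->
  (\int[gl]_z (f z)%:E = \int[gl]_z (s ^+ n.+2 * f (dil s z))%:E)%E.
Proof.
move=> s0 mf f0; have mEf : measurable_fun setT (EFin \o f) by exact/measurable_EFinP.
rewrite -(grushin_lebesgue_scale s0 mEf); last by move=> z; rewrite lee_fin.
under [in RHS]eq_integral do rewrite EFinM.
rewrite ge0_integralZl//.
- by apply: (measurableT_comp mEf); exact: measurable_dil.
- by move=> z _; rewrite lee_fin.
- by rewrite lee_fin exprn_ge0// ltW.
Qed.

(** On nonnegative reals the inverse is the power of exponent -1, also at 0, where both are 0. *)
Lemma measurable_inv_ge0 (f : mpt -> R) : (forall z, 0 <= f z) ->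
  measurable_fun setT f -> measurable_fun setT (fun z => (f z)^-1).
Proof.
move=> f0 mf; rewrite (_ : (fun z => _) = (fun z => f z `^ (-1))).
  exact: (measurableT_comp (measurable_powR _) mf).
by apply/funext => z; rewrite powR_inv1.
Qed.

(* The shell 1 <= rho <= Rmax contains the cube [1, 2]^(n + 1), which makes the
   constant of polar_identity positive. *)
Definition Rmax : R := 2 * n.+1%:R.
Definition chi (s : R) : R := \1_(`[Rmax^-1, 1]%classic : set R) s.

Lemma chi_ge0 s : 0 <= chi s. Proof. by rewrite /chi indicE. Qed.

Lemma measurable_chi : measurable_fun [set: R] chi.
Proof. exact: measurable_indic. Qed.

Lemma density_ge0 s z : 0 <= w z * chi s / rho z ^+ n.+2.
Proof.
apply: divr_ge0; last exact/exprn_ge0/rho_ge0.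
by apply: mulr_ge0; [exact: w_ge0|exact: chi_ge0].
Qed.

Definition weight z : R := w z * chi (rho z) / rho z ^+ n.+2.

Lemma weight_ge0 z : 0 <= weight z.
Proof. exact: density_ge0. Qed.

(** What remains of the average after the substitutions: the mass that the dilation-invariant
    density w rho^-Q gives to the shell [1 <= rho <= Rmax]. *)
Definition polar_constant : \bar R :=
  (\int[gl]_y (w y * chi (rho y)^-1 / rho y ^+ n.+2)%:E)%E.

Section function.
Variables (G : mpt -> R) (mG : measurable_fun setT G) (G0 : forall z, 0 <= G z).

(** The integrand in three forms, with equal integrals after a dilation of one variable; in [F3] the
    argument of [G] is the first variable alone, so its double integral factors. *)
Let F1 (q : mpt * mpt) : R := weight q.1 * (w q.2 * G (ray q.1 q.2)).
Let F2 (q : mpt * mpt) : R := w q.1 * chi (rho q.1) * (w q.2 * G (dil (rho q.2) q.1)).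
Let F3 (q : mpt * mpt) : R :=
  w q.1 * G q.1 * (w q.2 * chi (rho q.1 / rho q.2) / rho q.2 ^+ n.+2).

Let mf1 (f : mpt -> R) : measurable_fun setT f ->
  measurable_fun setT (fun q : mpt * mpt => f q.1).
Proof. by move=> mf; exact: (measurableT_comp mf (@measurable_fst _ _ mpt mpt)). Qed.

Let mf2 (f : mpt -> R) : measurable_fun setT f ->
  measurable_fun setT (fun q : mpt * mpt => f q.2).
Proof. by move=> mf; exact: (measurableT_comp mf (@measurable_snd _ _ mpt mpt)). Qed.

Let mw : measurable_fun setT (@w R n : mpt -> R) := @measurable_w R n.
Let mrho : measurable_fun setT (@rho R n : mpt -> R) := @measurable_rho R n.
Let mrhoV : measurable_fun setT (fun z : mpt => (rho z)^-1).
Proof. by apply: measurable_inv_ge0 => //; exact: rho_ge0. Qed.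

Let mrhoX : measurable_fun setT (fun z : mpt => (rho z ^+ n.+2)^-1).
Proof.
apply: measurable_inv_ge0; first by move=> z; rewrite exprn_ge0// rho_ge0.
exact: measurable_funX.
Qed.

Let mchirho : measurable_fun setT (fun z : mpt => chi (rho z)).
Proof. exact: (measurableT_comp measurable_chi mrho). Qed.

Let mweight : measurable_fun setT weight.
Proof. by apply: measurable_funM => //; exact: measurable_funM. Qed.

Let m1 : measurable_fun setT F1.
Proof.
apply: measurable_funM; first exact: mf1.
apply: measurable_funM; first exact: mf2.
have md : measurable_fun setT (fun q : mpt * mpt =>
    (rho q.2 / rho q.1 : measurableTypeR R, q.1)).
  apply: measurable_fun_pair; last exact: measurable_fst.
  by apply: measurable_funM; [exact: mf2|exact: (@mf1 (fun z => (rho z)^-1))].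
exact: (measurableT_comp mG (measurableT_comp (@measurable_dil2 R n) md)).
Qed.

Let m2 : measurable_fun setT F2.
Proof.
apply: measurable_funM.
  by apply: measurable_funM; [exact: mf1|exact: (@mf1 (fun z => chi (rho z)))].
apply: measurable_funM; first exact: mf2.
have md : measurable_fun setT (fun q : mpt * mpt =>
    (rho q.2 : measurableTypeR R, q.1)).
  by apply: measurable_fun_pair; [exact: mf2|exact: measurable_fst].
exact: (measurableT_comp mG (measurableT_comp (@measurable_dil2 R n) md)).
Qed.

Let m3 : measurable_fun setT F3.
Proof.
apply: measurable_funM.
  by apply: measurable_funM; exact: mf1.
apply: measurable_funM; last exact: (@mf2 (fun z => (rho z ^+ n.+2)^-1)).
apply: measurable_funM; first exact: mf2.
have md : measurable_fun setT (fun q : mpt * mpt => rho q.1 / rho q.2).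
  by apply: measurable_funM; [exact: mf1|exact: (@mf2 (fun z => (rho z)^-1))].
exact: (measurableT_comp measurable_chi md).
Qed.

Let F1_ge0 q : 0 <= F1 q.
Proof.
apply: mulr_ge0; first exact: weight_ge0.
by apply: mulr_ge0 => //; exact: w_ge0.
Qed.

Let F2_ge0 q : 0 <= F2 q.
Proof.
apply: mulr_ge0; first by apply: mulr_ge0; [exact: w_ge0|exact: chi_ge0].
by apply: mulr_ge0 => //; exact: w_ge0.
Qed.

Let F3_ge0 q : 0 <= F3 q.
Proof.
by apply: mulr_ge0; [apply: mulr_ge0 => //; exact: w_ge0|exact: density_ge0].
Qed.

Let msec1 (F : mpt * mpt -> R) z : measurable_fun setT F ->
  measurable_fun setT (fun y => F (z, y)).
Proof. by move=> mF; exact: (measurableT_comp mF (@measurable_pair1 _ _ mpt mpt z)). Qed.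

Let msec2 (F : mpt * mpt -> R) y : measurable_fun setT F ->
  measurable_fun setT (fun z => F (z, y)).
Proof. by move=> mF; exact: (measurableT_comp mF (@measurable_pair2 _ _ mpt mpt y)). Qed.

Let F12 z : (\int[gl]_y (F1 (z, y))%:E = \int[gl]_y (F2 (z, y))%:E)%E.
Proof.
have [Uz|/contrapT ->] := pselect (U z); last first.
  by apply: eq_integral => y _; rewrite /F1 /F2 /weight/= w0 !mul0r.
have r0 := rho_gt0 Uz.
rewrite (grushin_lebesgue_scaleR r0 (msec1 z m1) (fun y => F1_ge0 (z, y))).
apply: eq_integral => y _; congr EFin.
rewrite /F1 /F2 /weight /ray /= w_dil// rho_dil ?rho_ge0//.
rewrite [rho z * rho y]mulrC mulfK ?gt_eqF//.
by move: (G _) => g; field; rewrite expf_neq0 ?gt_eqF.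
Qed.

Let F23 y : (\int[gl]_z (F2 (z, y))%:E = \int[gl]_z (F3 (z, y))%:E)%E.
Proof.
have [Uy|/contrapT ->] := pselect (U y); last first.
  by apply: eq_integral => z _; rewrite /F2 /F3/= w0 !mul0r !mulr0.
have r0 := rho_gt0 Uy.
rewrite [RHS](grushin_lebesgue_scaleR r0 (msec2 y m3) (fun z => F3_ge0 (z, y))).
apply: eq_integral => z _; congr EFin.
rewrite /F2 /F3 /= w_dil// rho_dil ?rho_ge0//.
rewrite [rho y * rho z]mulrC mulfK ?gt_eqF//.
by move: (G _) => g; field; rewrite expf_neq0 ?gt_eqF.
Qed.

Let F3C z : (\int[gl]_y (F3 (z, y))%:E = (w z * G z)%:E * polar_constant)%E.
Proof.
have mc : measurable_fun setT (fun y : mpt => w y * chi (rho y)^-1 / rho y ^+ n.+2).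
  apply: measurable_funM => //; apply: measurable_funM => //.
  exact: (measurableT_comp measurable_chi mrhoV).
rewrite /polar_constant -ge0_integralZl//; last 3 first.
  exact/measurable_EFinP.
  by move=> y _; rewrite lee_fin density_ge0.
  by rewrite lee_fin mulr_ge0 ?w_ge0.
have [Uz|/contrapT ->] := pselect (U z); last first.
  by apply: eq_integral => y _; rewrite /F3/= w0 !mul0r mul0e.
have r0 := rho_gt0 Uz.
rewrite (grushin_lebesgue_scaleR r0 (msec1 z m3) (fun y => F3_ge0 (z, y))).
apply: eq_integral => y _.
rewrite -EFinM; congr EFin.
rewrite /F3 /= w_dil// rho_dil ?rho_ge0// [(rho z * _)^-1]invfM mulVKf ?gt_eqF//.
rewrite exprMn invfM.
have e0 : rho z ^+ n.+2 != 0 by rewrite expf_neq0 ?gt_eqF.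
by move: (G _) (rho y ^+ n.+2)^-1 (rho z ^+ n.+2) e0 => g a b b0; field.
Qed.

(* Tonelli, with the substitutions y -> dil rho(z) y, z -> dil rho(y)^-1 z and
   y -> dil rho(z) y in turn; dil s has Jacobian s^Q. *)
Lemma polar_identity :
  (\int[gl]_z \int[gl]_y (weight z * (w y * G (ray z y)))%:E =
   (\int[gl]_z (w z * G z)%:E) * polar_constant)%E.
Proof.
transitivity (\int[gl]_z \int[gl]_y (F2 (z, y))%:E)%E.
  by apply: eq_integral => z _; exact: F12.
rewrite (fubini_tonelli (EFin \o F2)); last 2 first.
  exact/measurable_EFinP.
  by move=> q; rewrite /= lee_fin F2_ge0.
transitivity (\int[gl]_y \int[gl]_z (F3 (z, y))%:E)%E.
  by apply: eq_integral => y _; exact: F23.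
rewrite -(fubini_tonelli (EFin \o F3)); last 2 first.
  exact/measurable_EFinP.
  by move=> q; rewrite /= lee_fin F3_ge0.
under eq_integral do rewrite F3C.
rewrite ge0_integralZr//.
- exact/measurable_EFinP/measurable_funM.
- by move=> z _; rewrite lee_fin mulr_ge0 ?w_ge0.
apply: integral_ge0 => y _.
by rewrite lee_fin density_ge0.
Qed.

Lemma measurable_polar : measurable_fun setT
  (fun z => \int[gl]_y (weight z * (w y * G (ray z y)))%:E)%E.
Proof.
apply: (measurable_fun_fubini_tonelli_F (m2 := gl) (EFin \o F1)).
  exact/measurable_EFinP.
by move=> q; rewrite /= lee_fin F1_ge0.
Qed.

Lemma measurable_ray_section z : measurable_fun setT (fun y => w y * G (ray z y)).
Proof.
apply: measurable_funM => //.
have md : measurable_fun setT (fun y : mpt => (rho y / rho z : measurableTypeR R, z)).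
  by apply: measurable_fun_pair => //; exact: measurable_funM.
exact: (measurableT_comp mG (measurableT_comp (@measurable_dil2 R n) md)).
Qed.

End function.

Lemma w_le1 z : w z <= 1.
Proof.
have [Uz|/contrapT ->] := pselect (U z); last by rewrite w0.
have H := p2N Uz; rewrite -(@expr_le1 _ 2) ?w_ge0// /w exprMn mulrC -H.
by rewrite ler_wpM2l ?sqr_ge0// /N lerDl mulr_ge0 ?sqr_ge0.
Qed.

Let c (y : mpt) : R := w y * chi (rho y)^-1 / rho y ^+ n.+2.

Let mc : measurable_fun setT c.
Proof.
have mV : measurable_fun setT (fun z : mpt => (rho z)^-1).
  by apply: measurable_inv_ge0; [exact: rho_ge0|exact: measurable_rho].
apply: measurable_funM; last first.
  apply: measurable_inv_ge0; first by move=> z; rewrite exprn_ge0// rho_ge0.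
  exact: (measurable_funX _ (@measurable_rho R n)).
apply: measurable_funM; first exact: measurable_w.
exact: (measurableT_comp measurable_chi mV).
Qed.

Let c_ge0 y : 0 <= c y.
Proof. exact: density_ge0. Qed.

Let Rmax_gt0 : 0 < Rmax. Proof. by rewrite /Rmax mulr_gt0. Qed.

Lemma polar_constant_lty : (polar_constant < +oo)%E.
Proof.
(* On this shell [w] and [chi] are at most 1 and the denominator is at least 1, so [c] is bounded by
   1 with bounded support. *)
have cP y : c y = 0 \/ 1 <= rho y <= Rmax.
  rewrite /c /chi indicE; case: (boolP (_ \in _)); last by left; rewrite mulr0 mul0r.
  rewrite inE /= in_itv/= => /andP[r1 r2']; right.
  have r0 : 0 < rho y.
    by rewrite -invr_gt0; apply: lt_le_trans r1; rewrite invr_gt0.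
  move: r1 r2'; rewrite lef_pV2 ?posrE// => ->; rewrite andbT.
  by rewrite -[X in _ <= X -> _]invr1 lef_pV2 ?posrE.
have ic : gl.-integrable setT (EFin \o c).
  apply: (integrable_bounded_support (B := box (Rmax ^+ 4 + 1)) (M := 1)) => //.
  - exact: measurable_box.
  - exact: box_lty.
  - move=> y; rewrite ger0_norm//; have [->//|/andP[r1 _]] := cP y.
    rewrite /c ler_pdivrMr; last by rewrite exprn_gt0// (lt_le_trans ltr01).
    rewrite mul1r (le_trans _ (exprn_ege1 _ r1))//.
    by rewrite mulr_ile1 ?w_ge0 ?chi_ge0 ?w_le1// /chi indicE; case: (_ \in _).
  - move=> y; have [//|/andP[_ r2']] := cP y; case.
    by apply: N_box; rewrite -rho4 lerXn2r// ?nnegrE ?rho_ge0// ltW.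
exact: (integrable_lty _ ic).
Qed.

(** A zero constant would make the density vanish almost everywhere, yet it is positive on the cube
    [1, 2]^(n + 1), which has measure 1. *)
Lemma polar_constant_gt0 : (0 < n)%N -> (0 < polar_constant)%E.
Proof.
move=> n0; have i0 : 'I_n := Ordinal n0.
rewrite lt_neqAle; apply/andP; split; last first.
  by apply: integral_ge0 => y _; rewrite lee_fin; exact: c_ge0.
apply/eqP => C0.
have : (\int[gl]_y `|(c y)%:E| = 0)%E.
  rewrite [RHS]C0; apply: eq_integral => y _.
  by rewrite gee0_abs// lee_fin; exact: c_ge0.
move=> /(ae_eq_integral_abs gl measurableT) => -[].
  exact/measurable_EFinP.
move=> N' [mN' N'0 cN'].
pose B : set mpt := [set x : 'rV[R]_n | forall i, 1 <= x ord0 i <= 2] `*` `[1, 2]%classic.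
have mB1 : measurable [set x : 'rV[R]_n | forall i, 1 <= x ord0 i <= 2].
  rewrite (_ : [set x | _] = \bigcap_(i in [set: 'I_n])
      ((fun x : 'rV[R]_n => x ord0 i : measurableTypeR R) @^-1` `[1, 2])).
    apply: fin_bigcap_measurable => // i _; rewrite -[X in measurable X]setTI.
    by apply: measurable_coord.
  by apply/seteqP; split => x /= H i; have := H i; rewrite /= in_itv//=; apply.
have mB : measurable B by exact: measurableX.
have BN : B `<=` N'.
  move=> y [y1 /=]; rewrite in_itv/= => y2; apply: cN' => /= /(_ I).
  case=> /eqP; apply/negP; rewrite gt_eqF// /c.
  have Xy i : 1 <= X i y ^+ 2 <= 4.
    have /andP[a b] := y1 i; rewrite -[_ ord0 i]/(X i y) in a b.
    by rewrite exprn_ege1//= (_ : 4 = 2 ^+ 2) ?lerXn2r ?nnegrE ?(le_trans _ a)//; ring.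
  have r2u : r2 y <= 4 * n%:R.
    apply: (@le_trans _ _ (\sum_(i < n) 4)).
      by apply: ler_sum => i _; have /andP[] := Xy i.
    by rewrite sumr_const card_ord -[4 *+ n]mulr_natr.
  have X0 : X i0 y != 0.
    by have /andP[a _] := Xy i0; apply/eqP => X0; move: a; rewrite X0 expr0n/= ler10.
  have Uy := X_neq0_punctured X0; have r0 := rho_gt0 Uy.
  have N1 : 1 <= N y.
    have /andP[a b] := y2; rewrite -[y.2]/(T y) in a b.
    have : 1 <= T y ^+ 2 by rewrite exprn_ege1.
    by have := sqr_ge0 (r2 y); rewrite /N; lra.
  (* Origin of [Rmax]: on the cube [N] is at most (4 n)^2 + 16, hence at most 16 (n + 1)^2, which is
     bounded by (2 (n + 1))^4. *)
  have N2 : N y <= Rmax ^+ 4.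
    have /andP[a b] := y2; rewrite -[y.2]/(T y) in a b.
    have T2 : T y ^+ 2 <= 4 by rewrite (_ : 4 = 2 ^+ 2) ?lerXn2r ?nnegrE ?(le_trans _ a)//; ring.
    have r22 : r2 y ^+ 2 <= (4 * n%:R) ^+ 2 by rewrite lerXn2r ?nnegrE ?r2_ge0 ?mulr_ge0.
    have n1 : 0 <= n%:R :> R by [].
    have m1 : 1 <= (n.+1%:R) :> R by rewrite ler1n.
    have m2 : (n.+1%:R : R) ^+ 2 <= n.+1%:R ^+ 4 by rewrite ler_weXn2l.
    move: r22 m2; rewrite /N /Rmax !exprMn -(natr1 n) => r22 m2; nra.
  have R1 : 1 <= rho y.
    by rewrite -(@ler_pXn2r _ 4) ?nnegrE ?rho_ge0// expr1n rho4.
  have R2 : rho y <= Rmax.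
    by rewrite -(@ler_pXn2r _ 4) ?nnegrE ?rho_ge0 ?(ltW Rmax_gt0)// rho4.
  rewrite /chi indicE mem_set; last first.
    by rewrite /= in_itv/= lef_pV2 ?posrE// R2 invf_le1.
  by rewrite mulr1 divr_gt0 ?exprn_gt0// mulr_gt0 ?p_gt0// (r2_gt0 X0).
have : (gl B <= gl N')%E by rewrite le_measure ?inE.
have E := @product_measure1E _ _ 'rV[R]_n (measurableTypeR R) R (rV_lebesgue n)
  lebesgue_measure _ `[1, 2]%classic mB1 (measurable_itv _).
rewrite N'0 [X in (X <= _)%E]E [X in (X * _)%E](rV_lebesgue_box n (a := 1) (b := 2)).
  rewrite /= lebesgue_measure_itv/= lte_fin ltr1n/= -EFinB -EFinM lee_fin.
  by rewrite (_ : 2 - 1 = 1 :> R) ?expr1n ?mulr1 ?ler10//; ring.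
by rewrite ltr1n.
Qed.

End polar.

(** * From radial test functions to arbitrary ones *)

Section radial_reduction.
Context {R : realType} {n : nat}.
Local Notation pt := ('rV[R]_n * R)%type.
Local Notation mpt := ('rV[R]_n * measurableTypeR R)%type.
Local Notation gl := (@grushin_lebesgue R n).
Local Notation U := (@punctured R n).

Lemma measurable_grushin_ball (r : \bar R) :
  measurable (grushin_ball r : set mpt).
Proof.
rewrite (_ : grushin_ball r = (EFin \o @rho R n) @^-1` `]-oo, r[); last first.
  by apply/seteqP; split => z; rewrite /grushin_ball /= in_itv.
rewrite -[X in measurable X]setTI.
have mrho : measurable_fun setT (EFin \o @rho R n : mpt -> \bar R).
  by apply/measurable_EFinP; exact: measurable_rho.
by apply: mrho => //; exact: emeasurable_itv.
Qed.

Lemma rellich_rhsE (r : \bar R) (W : R -> R) (u : pt -> R) :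
  Cc_smooth (grushin_ball r `\ 0) u -> rellich_rhs r W u =
  (\int[gl]_z (w z * (W (rho z) * `|u z| ^+ 2))%:E)%E.
Proof.
move=> [_ _ SA]; rewrite /rellich_rhs integral_mkcond.
have u0 z : ~ (grushin_ball r `\ 0) z -> u z = 0.
  move=> Bz; apply/eqP/negPn/negP => uz; apply: Bz; apply: SA.
  exact: subset_closure.
apply: eq_integral => z _; rewrite patchE /rellich_weight.
have [Bz|Bz] := pselect ((grushin_ball r `\ 0) z); last first.
  by rewrite u0// normr0 expr0n/= !(mulr0,mul0r); case: ifP.
by have [Bz1 Uz] := Bz; rewrite mem_set// grad_rho2// mulrC.
Qed.

Lemma integral_pos_neg (a f : mpt -> R) : (forall z, 0 <= a z) ->
  (\int[gl]_z (a z * f z)%:E = \int[gl]_z (a z * Num.max (f z) 0)%:E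
    - \int[gl]_z (a z * Num.max (- f z) 0)%:E)%E.
Proof.
move=> a0; rewrite integralE; congr (_ - _)%E; apply: eq_integral => z _.
  by rewrite funeposE maxr_pMr// mulr0 EFin_max.
by rewrite funenegE maxr_pMr// mulr0 mulrN EFin_max EFinN.
Qed.

Lemma max0_ge0 (x : R) : 0 <= Num.max x 0.
Proof. by rewrite le_max lexx orbT. Qed.

Section transfer.
Variables (r : \bar R) (W : R -> R) (u : pt -> R).
Hypotheses (n2 : (2 <= n)%N) (Cu : Cc_smooth (grushin_ball r `\ 0) u).
Hypothesis Wu : rellich_defined r W u.

Let G (z : mpt) : R := W (rho z) * `|u z| ^+ 2.

(** [rellich_defined] provides a Borel version of [G] times the squared gradient of [rho] only.
    Dividing it by [w] gives one of [G], once a coordinate hyperplane is added to the null set;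
    outside the ball [u] vanishes and 0 serves. *)
Lemma ae_eq_measurable : exists (g : mpt -> R) (N' : set mpt),
  [/\ measurable_fun setT g, measurable N', gl N' = 0 &
      forall z, ~ N' z -> G z = g z].
Proof.
have [[g [mg [N0 [mN0 N00 gN0]]]] _] := Wu.
have i0 : 'I_n by exact: (Ordinal (ltnW n2)).
have mX0 : measurable [set z : mpt | X i0 z = 0].
  rewrite -[X in measurable X]setTI.
  by have := measurable_X i0 measurableT (measurable_set1 0).
have mB := measurable_grushin_ball r.
exists (fun z => fine ((g \_ (grushin_ball r)) z) * (w z)^-1).
exists (N0 `|` [set z : mpt | X i0 z = 0]); split.
- apply: measurable_funM; last exact: (measurable_inv_ge0 w_ge0 (@measurable_w R n)).
  apply: measurableT_comp => //.
  by apply/(measurable_restrictT _ mB).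
- exact: measurableU.
- by rewrite measureU0//; exact: grushin_lebesgue_hyperplane.
move=> z /not_orP[Nz /eqP Xz].
have w0 : w z != 0.
  by rewrite gt_eqF// mulr_gt0 ?(r2_gt0 Xz) ?p_gt0//; exact: X_neq0_punctured Xz.
rewrite patchE; case: ifPn => [/set_mem Bz|/negP Bz]; last first.
  rewrite mul0r /G; have [_ _ SA] := Cu.
  suff -> : u z = 0 by rewrite normr0 expr0n mulr0.
  apply/eqP/negPn/negP => uz; apply: Bz; apply/mem_set.
  have : closure [set z | u z != 0] z by exact: subset_closure.
  by move=> /SA[].
have <- : rellich_weight W u z = g z.
  by apply: contrapT => H; apply: Nz; apply: gN0 => /= /(_ Bz).
by rewrite /= grad_rho2 ?mulfK//; exact: X_neq0_punctured Xz.
Qed.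

Hypothesis radial_le : forall v : pt -> R, Cc_smooth (grushin_ball r `\ 0) v ->
  grushin_radial v -> (rellich_rhs r W v <= rellich_lhs r v)%E.

(** The radial hypothesis applied to [u \o ray z], with the negative part moved to the right so that
    all three integrands are nonnegative and can be averaged over [z]. *)
Lemma ray_le z : U z ->
  (\int[gl]_y (w y * Num.max (G (ray z y)) 0)%:E <=
   \int[gl]_y (w y * A u (ray z y) ^+ 2)%:E +
   \int[gl]_y (w y * Num.max (- G (ray z y)) 0)%:E)%E.
Proof.
move=> Uz; have Cv := Cc_smooth_ray Uz Cu.
have := radial_le Cv (radial_ray z u).
rewrite (rellich_lhs_ray Uz Cu) (rellich_rhsE W Cv).
rewrite (eq_integral (fun y : mpt => (w y * G (ray z y))%:E)); last first.
  by move=> y _; rewrite /G rho_ray.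
rewrite (integral_pos_neg (fun y => G (ray z y)) w_ge0); apply: leB_leD.
  by apply: integral_ge0 => y _; rewrite lee_fin mulr_ge0 ?w_ge0 ?max0_ge0.
by apply: integral_ge0 => y _; rewrite lee_fin mulr_ge0 ?w_ge0 ?sqr_ge0.
Qed.

(* polar_identity for the indicator function of N'. *)
Lemma null_ray_section (N' : set mpt) : measurable N' -> gl N' = 0 ->
  exists M : set mpt, [/\ measurable M, gl M = 0 &
    forall z, ~ M z -> weight z != 0 -> exists M' : set mpt,
      [/\ measurable M', gl M' = 0 &
        forall y, ~ M' y -> w y = 0 \/ ~ N' (ray z y)]].
Proof.
move=> mN N0; pose J : mpt -> R := \1_N'.
have mJ : measurable_fun setT J by exact: measurable_indic.
have J0 z : 0 <= J z by rewrite /J indicE.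
have : (\int[gl]_z `|\int[gl]_y (weight z * (w y * J (ray z y)))%:E| = 0)%E.
  rewrite -[RHS](mul0e (@polar_constant R n)).
  rewrite (_ : 0 = \int[gl]_z (w z * J z)%:E)%E; last first.
    rewrite (integral_eq_off_null (g := cst 0%E) mN N0)//.
    - by rewrite integral0.
    - by move=> z; rewrite lee_fin mulr_ge0 ?w_ge0.
    - by move=> z Nz; rewrite /J indicE memNset//= mulr0.
  rewrite -polar_identity//; apply: eq_integral => z _; rewrite gee0_abs//.
  apply: integral_ge0 => y _.
  by rewrite lee_fin mulr_ge0 ?weight_ge0// mulr_ge0 ?w_ge0.
(* A nonnegative function with zero integral vanishes almost everywhere; this is used first in [z],
   then in [y] on each section of nonzero weight. *)
move=> /(ae_eq_integral_abs gl measurableT (measurable_polar mJ J0))[M [mM M0 MP]].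
exists M; split=> // z Mz wz.
have Jz : (\int[gl]_y `|(w y * J (ray z y))%:E| = 0)%E.
  have : (\int[gl]_y (weight z * (w y * J (ray z y)))%:E = 0)%E.
    by apply: contrapT => H; apply: Mz; apply: MP => /= /(_ I).
  under eq_integral do rewrite EFinM.
  rewrite ge0_integralZl//; last 3 first.
  - by apply/measurable_EFinP; exact: measurable_ray_section.
  - by move=> y _; rewrite lee_fin mulr_ge0 ?w_ge0.
  - by rewrite lee_fin weight_ge0.
  move=> /eqP; rewrite mule_eq0 => /orP[|/eqP H].
    by rewrite eqe (negbTE wz).
  rewrite -[RHS]H; apply: eq_integral => y _; rewrite gee0_abs//.
  by rewrite lee_fin mulr_ge0 ?w_ge0.
have [|M' [mM' M'0 M'P]] := (ae_eq_integral_abs gl measurableT _).1 Jz.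
  by apply/measurable_EFinP; exact: measurable_ray_section.
exists M'; split=> // y M'y.
have : (w y * J (ray z y))%:E = 0%E.
  by apply: contrapT => H; apply: M'y; apply: M'P => /= /(_ I).
case=> /eqP; rewrite mulf_eq0 => /orP[/eqP ->|]; [by left|right => Nr].
by move: b; rewrite /J indicE mem_set// oner_eq0.
Qed.

Lemma integral_ray_off_null (N' : set mpt) (f g : mpt -> R) z :
  (exists M' : set mpt, [/\ measurable M', gl M' = 0 &
        forall y, ~ M' y -> w y = 0 \/ ~ N' (ray z y)]) ->
  (forall x, 0 <= f x) -> (forall x, 0 <= g x) ->
  (forall x, ~ N' x -> f x = g x) ->
  (\int[gl]_y (w y * f (ray z y))%:E = \int[gl]_y (w y * g (ray z y))%:E)%E.
Proof.
move=> [M' [mM' M'0 M'P]] f0 g0 fg.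
apply: (integral_eq_off_null mM' M'0).
- by move=> y; rewrite lee_fin mulr_ge0 ?w_ge0.
- by move=> y; rewrite lee_fin mulr_ge0 ?w_ge0.
by move=> y /M'P[->|/fg ->]//; rewrite !mul0r.
Qed.

Lemma measurable_A_sqr : measurable_fun setT (fun z : mpt => A u z ^+ 2).
Proof.
have [su cS SA] := Cu; have Ciu := smooth_Cinf su.
apply: (@measurable_funX _ _ _ _ (A u : mpt -> R)).
apply: continuous_measurable_pt.
apply: (off_continuous (S := closure [set z | u z != 0])).
- exact: closed_closure.
- by move=> /SA[_]; apply.
- exact: Cinf_A.
- apply: off_A; first exact: closed_closure.
  by move=> y Sy; apply/eqP/negPn/negP => uy; apply: Sy; exact: subset_closure.
Qed.

Lemma rellich_rhs_le_A :
  (rellich_rhs r W u <= \int[gl]_z (w z * A u z ^+ 2)%:E)%E.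
Proof.
have [g [N' [mg mN N0 gG]]] := ae_eq_measurable.
have [M [mM M0 MP]] := null_ray_section mN N0.
have wf_ge0 (f : mpt -> R) : (forall z, 0 <= f z) -> (0 <= \int[gl]_z (w z * f z)%:E)%E.
  by move=> f0; apply: integral_ge0 => z _; rewrite lee_fin mulr_ge0 ?w_ge0.
have wfr_ge0 (f : mpt -> R) z : (forall z, 0 <= f z) ->
    (0 <= \int[gl]_y (weight z * (w y * f (ray z y)))%:E)%E.
  move=> f0; apply: integral_ge0 => y _.
  by rewrite lee_fin mulr_ge0 ?weight_ge0// mulr_ge0 ?w_ge0.
pose gp z := Num.max (g z) 0; pose gm z := Num.max (- g z) 0.
have gp0 z : 0 <= gp z := max0_ge0 _.
have gm0 z : 0 <= gm z := max0_ge0 _.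
have A0 (z : mpt) : 0 <= A u z ^+ 2 := sqr_ge0 _.
have mgp : measurable_fun setT gp by exact: measurable_maxr.
have mgm : measurable_fun setT gm.
  by apply: measurable_maxr => //; exact: measurableT_comp.
have mA := measurable_A_sqr.
(* With the negative part on the right all integrands are nonnegative, and [integral_eq_off_null]
   allows the Borel function [g] to replace [G]. *)
rewrite (rellich_rhsE W Cu) (integral_pos_neg _ w_ge0).
apply: leD_leB; first by apply: wf_ge0 => z; exact: max0_ge0.
rewrite (integral_eq_off_null (g := fun z : mpt => (w z * gp z)%:E) mN N0); last 3 first.
- by move=> z; rewrite lee_fin mulr_ge0 ?w_ge0 ?max0_ge0.
- by move=> z; rewrite lee_fin mulr_ge0 ?w_ge0.
- by move=> z /gG; rewrite /gp /G => ->.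
rewrite [X in (_ <= _ + X)%E](integral_eq_off_null
  (g := fun z : mpt => (w z * gm z)%:E) mN N0); last 3 first.
- by move=> z; rewrite lee_fin mulr_ge0 ?w_ge0 ?max0_ge0.
- by move=> z; rewrite lee_fin mulr_ge0 ?w_ge0.
- by move=> z /gG; rewrite /gm /G => ->.
have C0 := @polar_constant_gt0 R n (ltnW n2).
have Cfin : polar_constant (R := R) (n := n) \is a fin_num.
  by rewrite ge0_fin_numE ?ltW//; exact: polar_constant_lty.
(* Multiplication by the positive finite constant makes each integral the right-hand side of
   [polar_identity], so the inequality only has to be checked for almost every [z] under the
   average. *)
rewrite -(lee_pmul2r Cfin C0) (ge0_muleDl _ (wf_ge0 (fun z => A u z ^+ 2) A0) (wf_ge0 _ gm0)).
rewrite -!polar_identity//.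
rewrite -ge0_integralD//; first last.
- exact: measurable_polar.
- by move=> z _; exact: wfr_ge0.
- exact: (measurable_polar mA).
- by move=> z _; exact: (wfr_ge0 (fun z => A u z ^+ 2)).
apply: ae_ge0_le_integral => //.
- by move=> z _; exact: wfr_ge0.
- exact: measurable_polar.
- by move=> z _; apply: adde_ge0; [exact: (wfr_ge0 (fun z => A u z ^+ 2))|exact: wfr_ge0].
- by apply: emeasurable_funD; [exact: (measurable_polar mA)|exact: measurable_polar].
exists M; split=> // z /= /not_implyP[_] H; apply: contrapT => Mz; apply: H.
(* Points of zero weight, among them the origin, contribute nothing; at the others
   [null_ray_section] provides the null set off which [G] and [g] may be exchanged after composition
   with [ray z]. *)
have [w0|w0] := eqVneq (weight z) 0.
  have Z (f : mpt -> R) : (\int[gl]_y (weight z * f y)%:E = 0)%E.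
    by under eq_integral do rewrite w0 mul0r; exact: integral0.
  by rewrite !Z add0e.
have Uz : U z by move=> zE; move: w0; rewrite zE /weight w0 !mul0r eqxx.
have wZ (f : mpt -> R) : measurable_fun setT f -> (forall z, 0 <= f z) ->
    (\int[gl]_y (weight z * (w y * f (ray z y)))%:E =
     (weight z)%:E * \int[gl]_y (w y * f (ray z y))%:E)%E.
  move=> mf f0; under eq_integral do rewrite EFinM.
  rewrite ge0_integralZl//.
  - by apply/measurable_EFinP; exact: measurable_ray_section.
  - by move=> y _; rewrite lee_fin mulr_ge0 ?w_ge0.
  - by rewrite lee_fin weight_ge0.
rewrite (wZ _ mgp gp0) (wZ _ mA A0) (wZ _ mgm gm0) -ge0_muleDr.
- rewrite lee_wpmul2l ?lee_fin ?weight_ge0//.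
  have /= Mz' := MP z Mz w0; have := ray_le Uz.
  rewrite (integral_ray_off_null (g := gp) (f := fun z => Num.max (G z) 0) Mz')//; last 2 first.
  + by move=> x; exact: max0_ge0.
  + by move=> x /gG ->.
  rewrite (integral_ray_off_null (g := gm) (f := fun z => Num.max (- G z) 0) Mz')//.
  + by move=> x; exact: max0_ge0.
  + by move=> x /gG ->.
- by apply: integral_ge0 => y _; rewrite lee_fin mulr_ge0 ?w_ge0 ?sqr_ge0.
- by apply: integral_ge0 => y _; rewrite lee_fin mulr_ge0 ?w_ge0.
Qed.

End transfer.
End radial_reduction.

Theorem theorem6p2 (R : realType) (n : nat) (r : \bar R) (W : R -> R)
    (hn : (2 <= n)%N) (hr : (0 < r)%E)
    (hW : forall u : 'rV[R]_n * R -> R,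
      Cc_smooth (grushin_ball r `\ 0) u -> rellich_defined r W u) :
  (forall u : 'rV[R]_n * R -> R, Cc_smooth (grushin_ball r `\ 0) u ->
     (rellich_rhs r W u <= rellich_lhs r u)%E) <->
  (forall u : 'rV[R]_n * R -> R, Cc_smooth (grushin_ball r `\ 0) u ->
     grushin_radial u -> (rellich_rhs r W u <= rellich_lhs r u)%E).
Proof.
split=> [H u Cu _|H u Cu]; first exact: H.
exact: le_trans (rellich_rhs_le_A hn Cu (hW u Cu) H) (integral_radial_part_le_rellich_lhs Cu hn).
Qed.
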